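(* Let $\Phi\in\mathbb T$ be irrational, $\lambda_1\in(0,1]$, $\lambda_2\in[0,1]$ and $z\in\mathbb C\setminus\{0\}$. Then $$L_{\lambda_1,\lambda_2,\Phi}(z)\ge\log\left[\frac{\lambda_2(1+\lambda_1')}{\lambda_1(1+\lambda_2')}\right].$$ In particular $L_{\lambda_1,\lambda_2,\Phi}(z)>0$ for all $z\in\partial\mathbb D$ whenever $0<\lambda_1<\lambda_2\le1$, and for every $\lambda_2\in(0,1]$ and $z\in\partial\mathbb D$, $\lim_{\lambda_1\downarrow0}L_{\lambda_1,\lambda_2,\Phi}(z)=\infty$.
   Context: For $\lambda\in[0,1]$ put $\lambda'=\sqrt{1-\lambda^2}$; $\mathbb T=\mathbb R/\mathbb Z$, $\partial\mathbb D$ the unit circle. Writing $\mathrm c(\theta)=\cos(2\pi\theta)$, $\mathrm s(\theta)=\sin(2\pi\theta)$, for $\lambda_1\in(0,1]$, $\lambda_2\in[0,1]$, $z\in\mathbb C\setminus\{0\}$ define $$A_{\lambda_1,\lambda_2,z}(\theta)=\frac{1}{\lambda_2\mathrm c(\theta)-i\lambda_2'}\begin{bmatrix}\lambda_1^{-1}z^{-1}+2\lambda_1'\lambda_1^{-1}\lambda_2\mathrm s(\theta)+z\lambda_1'^2\lambda_1^{-1} & -\lambda_2\mathrm s(\theta)-\lambda_1'z\\ -\lambda_2\mathrm s(\theta)-\lambda_1'z & \lambda_1 z\end{bmatrix}$$ (the transfer matrix cocycle of the unitary almost-Mathieu operator), its iterates $A^n(\theta)=A(\theta+(n-1)\Phi)\cdots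 A(\theta+\Phi)A(\theta)$, and $L_{\lambda_1,\lambda_2,\Phi}(z)=\lim_{n\to\infty}\frac1n\int_{\mathbb T}\log\|A^n_{\lambda_1,\lambda_2,z}(\theta)\|d\theta$. (The right-hand side of the inequality is interpreted as $-\infty$ when $\lambda_2=0$.) *)

(* Defs.v *)
From mathcomp Require Import all_boot all_order all_algebra.
From mathcomp Require Import all_classical all_reals all_analysis.
From mathcomp Require Import complex.

Set Implicit Arguments.
Unset Strict Implicit.
Unset Printing Implicit Defensive.

Import Order.TTheory GRing.Theory Num.Theory.
Local Open Scope classical_set_scope.
Local Open Scope ring_scope.

Section UAMO.
Variable R : realType.

Definition lamp (l : R) : R := Num.sqrt (1 - l ^+ 2).

(* c(theta) = cos(2 pi theta), s(theta) = sin(2 pi theta); theta in R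
   represents a point of T = R/Z (all functions below are 1-periodic). *)
Definition cth (t : R) : R := cos (2 * pi * t).
Definition sth (t : R) : R := sin (2 * pi * t).

Definition RC (x : R) : R[i] := Complex x 0.

Definition cmod (w : R[i]) : R := Num.sqrt (complex.Re w ^+ 2 + complex.Im w ^+ 2).

Definition Amat (l1 l2 : R) (z : R[i]) (t : R) : 'M[R[i]]_2 :=
  let d : R[i] := Complex (l2 * cth t) (- lamp l2) in
  let a11 : R[i] := z^-1 / RC l1 + RC (2 * lamp l1 * l2 * sth t / l1)
                    + z * RC (lamp l1 ^+ 2 / l1) in
  let a12 : R[i] := - RC (l2 * sth t) - RC (lamp l1) * z in
  let a22 : R[i] := RC l1 * z in
  d^-1 *: \matrix_(i < 2, j < 2)
     (if (i == 0 :> nat) then (if (j == 0 :> nat) then a11 else a12)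
      else (if (j == 0 :> nat) then a12 else a22)).

Fixpoint Aiter (l1 l2 : R) (z : R[i]) (Phi : R) (n : nat) (t : R)
  : 'M[R[i]]_2 :=
  match n with
  | 0%N => 1%:M
  | n'.+1 => Amat l1 l2 z (t + n'%:R * Phi) *m Aiter l1 l2 z Phi n' t
  end.

Definition vnorm (v : 'cV[R[i]]_2) : R :=
  Num.sqrt (cmod (v 0 0) ^+ 2 + cmod (v 1 0) ^+ 2).

Definition opnorm (M : 'M[R[i]]_2) : R :=
  sup [set r : R | exists v : 'cV[R[i]]_2, vnorm v = 1 /\ r = vnorm (M *m v)].

Definition lyap_seq (l1 l2 : R) (Phi : R) (z : R[i]) (n : nat) : \bar R :=
  ((n%:R)^-1)%:E *
  (\int[@lebesgue_measure R]_(t in `[0%R, 1%R])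
      (ln (opnorm (Aiter l1 l2 z Phi n t)))%:E)%E.

Definition lyap (l1 l2 : R) (Phi : R) (z : R[i]) : \bar R :=
  lim (lyap_seq l1 l2 Phi z @ \oo).

End UAMO.

(* Main.v *)
(** For w = e^{2 pi i t} put A = N / d with d the scalar denominator.  Since |det A| = 1
    whenever d <> 0, log ||A^n|| is nonnegative, and subadditivity along the rotation (Fekete)
    makes the limit defining L exist for every frequency.  The bound is Herman's
    subharmonicity argument: w^n N^n is a polynomial in w whose constant term is, up to a
    unimodular scalar, (l2/2)^n C^n for a real symmetric matrix C having an eigenvalue
    x = (1 + l1')/l1.  Pairing with the corresponding unit eigenvector gives a scalar
    polynomial p with |p(0)| = (l2 x / 2)^n and |p(w)| <= ||N^n||, so Jensen's inequality
    yields a mean of log ||N^n|| of at least n log (l2 x / 2).  On the other hand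
    |d| = (1 + l2')/2 |1 - i rho w| |1 + i rho w| with rho = l2 / (1 + l2') <= 1, so log |d|
    has mean log ((1 + l2')/2).  Both facts rest on the vanishing of the mean of log |1 - a w|
    for |a| <= 1.  If |a| < 1, averaging over the half-period shift w -> -w replaces
    log |1 - a w| by half of log |1 - a^2 w^2|, and iterating kills the mean; |a| = 1 follows
    by passing to the limit. *)

Require Import Defs.
From mathcomp Require Import all_boot all_order all_algebra.
From mathcomp Require Import all_classical all_reals all_analysis.
From mathcomp Require Import measurable_realfun complex ring lra.

Set Implicit Arguments.
Unset Strict Implicit.
Unset Printing Implicit Defensive.

Import Order.TTheory GRing.Theory Num.Theory.
Import numFieldNormedType.Exports.
Local Open Scope classical_set_scope.
Local Open Scope ring_scope.

Import Normc.

(** * Euclidean norm on pairs of complex numbers and operator norm of 2 x 2 matrices *)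

Section ComplexModulus.
Variable R : realType.
Implicit Types (x y z : R[i]) (u v w : 'cV[R[i]]_2) (M N : 'M[R[i]]_2).

Lemma cmodE z : cmod z = normc z.
Proof. by case: z. Qed.

Lemma cmod_ge0 z : 0 <= cmod z.
Proof. exact: sqrtr_ge0. Qed.

Lemma cmodM x y : cmod (x * y) = cmod x * cmod y.
Proof. by rewrite !cmodE normcM. Qed.

Lemma cmodV x : cmod x^-1 = (cmod x)^-1.
Proof. by rewrite !cmodE normcV. Qed.

Lemma cmod0 : cmod (0 : R[i]) = 0.
Proof. by rewrite cmodE normc0. Qed.

Lemma cmod1 : cmod (1 : R[i]) = 1.
Proof. by rewrite cmodE normc1. Qed.

Lemma cmod_eq0 z : (cmod z == 0) = (z == 0).
Proof.
apply/eqP/eqP => [|->]; last exact: cmod0.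
by rewrite cmodE; exact: eq0_normc.
Qed.

Lemma cmod_gt0 z : (0 < cmod z) = (z != 0).
Proof. by rewrite lt0r cmod_eq0 cmod_ge0 andbT. Qed.

Lemma cmodN z : cmod (- z) = cmod z.
Proof. by rewrite !cmodE normcN. Qed.

Lemma ler_cmodD x y : cmod (x + y) <= cmod x + cmod y.
Proof. by rewrite !cmodE le_normcD. Qed.

Lemma ler_cmodB x y : cmod (x - y) <= cmod x + cmod y.
Proof. by rewrite -(cmodN y) ler_cmodD. Qed.

Lemma ler_cmod_dist x y : cmod x - cmod y <= cmod (x - y).
Proof. by rewrite lerBlDr -{1}(subrK y x) ler_cmodD. Qed.

Lemma cmodX x n : cmod (x ^+ n) = cmod x ^+ n.
Proof. by elim: n => [|n IH]; rewrite ?expr0 ?cmod1// !exprS cmodM IH. Qed.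

Lemma cmod_sqr z : cmod z ^+ 2 = complex.Re z ^+ 2 + complex.Im z ^+ 2.
Proof. by rewrite sqr_sqrtr// addr_ge0 ?sqr_ge0. Qed.

Lemma cmod_RC (r : R) : cmod (RC r) = `|r|.
Proof. by rewrite /cmod/= expr0n addr0 sqrtr_sqr. Qed.

Lemma cmodJ z : cmod (conjc z) = cmod z.
Proof. by case: z => a b; rewrite /cmod/= sqrrN. Qed.

Lemma vnorm_sqr v : vnorm v ^+ 2 = cmod (v 0 0) ^+ 2 + cmod (v 1 0) ^+ 2.
Proof. by rewrite sqr_sqrtr// addr_ge0 ?sqr_ge0. Qed.

Lemma vnorm_ge0 v : 0 <= vnorm v.
Proof. exact: sqrtr_ge0. Qed.

Lemma vnormZ c v : vnorm (c *: v) = cmod c * vnorm v.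
Proof.
rewrite /vnorm !mxE !cmodM !exprMn -mulrDr sqrtrM ?sqr_ge0//.
by rewrite sqrtr_sqr ger0_norm// cmod_ge0.
Qed.

Lemma vnorm_eq0 v : vnorm v = 0 -> v = 0.
Proof.
move=> /(congr1 (fun a => a ^+ 2)); rewrite vnorm_sqr expr0n/= => /eqP.
rewrite paddr_eq0 ?sqr_ge0// !sqrf_eq0 !cmod_eq0 => /andP[/eqP v0 /eqP v1].
apply/matrixP => i j; rewrite (ord1 j) mxE.
by case: i => -[|[|//]] i; [rewrite -v0|rewrite -v1]; congr (v _ _); exact/val_inj.
Qed.

(** Lagrange's identity: the squared sides differ by [(a * d - b * c) ^+ 2]. *)
Lemma cauchy_schwarz2 (a b c d : R) :
  a * c + b * d <= Num.sqrt (a ^+ 2 + b ^+ 2) * Num.sqrt (c ^+ 2 + d ^+ 2).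
Proof.
rewrite -sqrtrM ?addr_ge0 ?sqr_ge0//.
apply: (le_trans (ler_norm _)); rewrite -sqrtr_sqr ler_sqrt.
  rewrite -subr_ge0; suff -> : (a ^+ 2 + b ^+ 2) * (c ^+ 2 + d ^+ 2) -
    (a * c + b * d) ^+ 2 = (a * d - b * c) ^+ 2 by rewrite sqr_ge0.
  ring.
by rewrite mulr_ge0 ?addr_ge0 ?sqr_ge0.
Qed.

Lemma cmod_dot x1 x2 y1 y2 :
  cmod (x1 * y1 + x2 * y2) <=
  Num.sqrt (cmod x1 ^+ 2 + cmod x2 ^+ 2) * Num.sqrt (cmod y1 ^+ 2 + cmod y2 ^+ 2).
Proof. by apply: le_trans (cauchy_schwarz2 _ _ _ _); rewrite -!cmodM ler_cmodD. Qed.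

Lemma vnormD u v : vnorm (u + v) <= vnorm u + vnorm v.
Proof.
rewrite -(@ler_pXn2r _ 2) ?nnegrE ?addr_ge0 ?vnorm_ge0//.
rewrite sqrrD !vnorm_sqr !mxE.
have h x y : cmod (x + y) ^+ 2 <= (cmod x + cmod y) ^+ 2.
  by rewrite ler_pXn2r ?nnegrE ?addr_ge0 ?cmod_ge0// ler_cmodD.
apply: (le_trans (lerD (h _ _) (h _ _))).
have := cauchy_schwarz2 (cmod (u 0 0)) (cmod (u 1 0)) (cmod (v 0 0)) (cmod (v 1 0)).
rewrite -!/(vnorm _) !sqrrD; lra.
Qed.

Lemma vnorm_le v : vnorm v <= cmod (v 0 0) + cmod (v 1 0).
Proof.
have h : 0 <= cmod (v 0 0) + cmod (v 1 0) by rewrite addr_ge0 ?cmod_ge0.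
rewrite -(@ler_pXn2r _ 2) ?nnegrE ?vnorm_ge0// vnorm_sqr sqrrD.
have := cmod_ge0 (v 0 0); have := cmod_ge0 (v 1 0); nra.
Qed.

Lemma cmod_le_vnorm v i : cmod (v i 0) <= vnorm v.
Proof.
rewrite -(@ler_pXn2r _ 2) ?nnegrE ?vnorm_ge0 ?cmod_ge0// vnorm_sqr.
case: i => -[|[|//]] i.
  rewrite (_ : Ordinal i = 0) ?lerDl ?sqr_ge0//; exact/val_inj.
rewrite (_ : Ordinal i = 1) ?lerDr ?sqr_ge0//; exact/val_inj.
Qed.

Lemma mulmx2E M v i : (M *m v) i 0 = M i 0 * v 0 0 + M i 1 * v 1 0.
Proof. by rewrite mxE big_ord_recl big_ord1; congr (_ + _ * _); congr (_ _ _); exact/val_inj. Qed.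

(** A crude majorant of [opnorm]: it shows that the supremum defining the norm is finite, and it is
    visibly continuous in the entries. *)
Definition entrysum M := cmod (M 0 0) + cmod (M 0 1) + (cmod (M 1 0) + cmod (M 1 1)).

Lemma vnorm_mulmx_le M v : vnorm (M *m v) <= entrysum M * vnorm v.
Proof.
apply: (le_trans (vnorm_le _)); rewrite !mulmx2E.
have h i j : cmod (M i j * v j 0) <= cmod (M i j) * vnorm v.
  by rewrite cmodM ler_wpM2l ?cmod_ge0// cmod_le_vnorm.
by rewrite /entrysum !mulrDl !lerD// (le_trans (ler_cmodD _ _))// lerD.
Qed.

Let unit_images M := [set r : R | exists v, vnorm v = 1 /\ r = vnorm (M *m v)].

Lemma vnorm_delta i : vnorm (delta_mx i 0 : 'cV[R[i]]_2) = 1.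
Proof.
case: i => -[|[|//]] i; rewrite /vnorm !mxE/= ?cmod0 ?cmod1;
  by rewrite expr1n expr0n/= ?addr0 ?add0r sqrtr1.
Qed.

Let unit_images_sup M : has_sup (unit_images M).
Proof.
split; first by exists (vnorm (M *m delta_mx 0 0)), (delta_mx 0 0); rewrite vnorm_delta.
by exists (entrysum M) => _ [v [v1 ->]]; rewrite (le_trans (vnorm_mulmx_le _ _))// v1 mulr1.
Qed.

Lemma opnorm_le M (c : R) :
  (forall v, vnorm v = 1 -> vnorm (M *m v) <= c) -> opnorm M <= c.
Proof.
move=> h; apply: ge_sup; first by case: (unit_images_sup M).
by move=> _ [v [v1 ->]]; exact: h.
Qed.

Lemma vnorm_mulmx M v : vnorm (M *m v) <= opnorm M * vnorm v.
Proof.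
have [/vnorm_eq0 ->|v0] := eqVneq (vnorm v) 0.
  by rewrite mulmx0 -(scale0r 0) vnormZ cmod0 !mul0r mulr0.
have vp : 0 < vnorm v by rewrite lt0r v0 vnorm_ge0.
have cE : cmod (RC (vnorm v)^-1) = (vnorm v)^-1.
  by rewrite cmod_RC ger0_norm// invr_ge0 ltW.
rewrite -ler_pdivrMr// mulrC -cE -vnormZ scalemxAr.
apply: ub_le_sup; first by case: (unit_images_sup M).
by exists (RC (vnorm v)^-1 *: v); rewrite vnormZ cE mulVf.
Qed.

Lemma opnorm_ge0 M : 0 <= opnorm M.
Proof.
have := vnorm_mulmx M (delta_mx 0 0).
by rewrite vnorm_delta mulr1; apply: le_trans; exact: vnorm_ge0.
Qed.

Lemma opnorm_le_entrysum M : opnorm M <= entrysum M.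
Proof. by apply: opnorm_le => v v1; rewrite (le_trans (vnorm_mulmx_le _ _))// v1 mulr1. Qed.

Lemma opnormM M N : opnorm (M *m N) <= opnorm M * opnorm N.
Proof.
apply: opnorm_le => v v1; rewrite -mulmxA (le_trans (vnorm_mulmx _ _))//.
by rewrite ler_wpM2l ?opnorm_ge0// (le_trans (vnorm_mulmx _ _))// v1 mulr1.
Qed.

Lemma opnormD M N : opnorm (M + N) <= opnorm M + opnorm N.
Proof.
apply: opnorm_le => v v1; rewrite mulmxDl (le_trans (vnormD _ _))//.
by rewrite lerD// (le_trans (vnorm_mulmx _ _))// v1 mulr1.
Qed.

Lemma opnormZ c M : opnorm (c *: M) = cmod c * opnorm M.
Proof.
have h b N : opnorm (b *: N) <= cmod b * opnorm N.
  apply: opnorm_le => v v1; rewrite -scalemxAl vnormZ ler_wpM2l ?cmod_ge0//.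
  by rewrite (le_trans (vnorm_mulmx _ _))// v1 mulr1.
apply/eqP; rewrite eq_le h/=.
have [->|c0] := eqVneq c 0; first by rewrite cmod0 mul0r opnorm_ge0.
(* The reverse inequality is [h] for the scalar [c^-1] and the matrix [c *: M]. *)
by rewrite mulrC -ler_pdivlMr ?cmod_gt0// mulrC -cmodV -{1}(scalerK c0 M) h.
Qed.

Lemma opnorm_dist M N : `|opnorm M - opnorm N| <= entrysum (M - N).
Proof.
have h A B : opnorm A - opnorm B <= entrysum (A - B).
  rewrite lerBlDr (le_trans _ (lerD (opnorm_le_entrysum _) (lexx _)))//.
  by rewrite -{1}(subrK B A) opnormD.
rewrite ler_norml h andbT lerNl opprB (le_trans (h _ _))//.
by rewrite /entrysum !mxE -[in leRHS]cmodN -[X in _ + X + _]cmodN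
  -[X in _ + (X + _)]cmodN -[X in _ + (_ + X)]cmodN !opprB.
Qed.

Lemma det_mx2 M : \det M = M 0 0 * M 1 1 - M 0 1 * M 1 0.
Proof.
rewrite (expand_det_row _ 0) big_ord_recl big_ord1 /cofactor !det_mx11 !mxE /=.
rewrite expr0 expr1 mul1r mulN1r mulrN.
by congr (_ * M _ _ - M _ _ * M _ _); apply/val_inj.
Qed.

(** Hadamard's inequality: |det M| is at most the product of the lengths of the two columns, and
    these are images of unit basis vectors. *)
Lemma cmod_det2_le M : cmod (\det M) <= opnorm M ^+ 2.
Proof.
rewrite det_mx2.
have e j : Num.sqrt (cmod (M 0 j) ^+ 2 + cmod (M 1 j) ^+ 2) <= opnorm M.
  have := vnorm_mulmx M (delta_mx j 0); rewrite vnorm_delta mulr1.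
  by rewrite -colE /vnorm !mxE.
have := cmod_dot (M 0 0) (M 1 0) (M 1 1) (- M 0 1).
rewrite [M 1 0 * _]mulrN [M 1 0 * _]mulrC cmodN => /le_trans; apply.
rewrite expr2; apply: (ler_pM (sqrtr_ge0 _) (sqrtr_ge0 _) (e 0)).
by rewrite addrC; exact: e.
Qed.

End ComplexModulus.

(** * Lebesgue integrals of periodic functions under translation *)

Section PeriodicIntegral.
Variable R : realType.
Notation mu := (@lebesgue_measure R).

Lemma measurable_shift (a : R) :
  measurable_fun setT (fun x : measurableTypeR R => x + a : measurableTypeR R).
Proof. exact: measurable_funD. Qed.

(** Translation invariance, from the uniqueness of the measure with the prescribed values on
    half-open intervals. *)
Lemma pushforward_lebesgue_shift (a : R) (A : set (measurableTypeR R)) :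
  measurable A -> pushforward mu (fun x => x + a : measurableTypeR R) A = mu A.
Proof.
move=> mA; apply/esym/lebesgue_measure_unique => //=.
  exact: measurable_shift.
move=> _ _ [[b c]] _ <-.
rewrite /pushforward (_ : _ @^-1` _ = `]b - a, c - a]%classic); last first.
  apply/seteqP; split => x; rewrite /= !in_itv/= => /andP[? ?]; apply/andP; split; lra.
rewrite !lebesgue_measure_itv/= !lte_fin ltrD2r; case: ifP => // _.
by rewrite -!EFinB opprB addrA subrK.
Qed.

Lemma ge0_integral_shift (a : R) (b c : R) (f : R -> \bar R) :
  measurable_fun [set: R] f -> (forall r, 0 <= f r)%E ->
  (\int[mu]_(x in `[b, c[) f (x + a)%R = \int[mu]_(x in `[(b + a)%R, (c + a)%R[) f x)%E.
Proof.
move=> mf f0.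
rewrite (_ : `[b, c[%classic = (fun x => x + a : measurableTypeR R) @^-1` `[b + a, c + a[%classic); last first.
  by apply/seteqP; split => x; rewrite /= !in_itv/= => /andP[? ?]; apply/andP; split; lra.
rewrite -(ge0_integral_pushforward (measurable_shift a))//=; last exact: measurable_funS mf.
by apply: eq_measure_integral => [|? A mA _]; [exact: measurable_shift|exact: pushforward_lebesgue_shift].
Qed.

Lemma periodic_nat (T : Type) (f : R -> T) (n : nat) t :
  (forall t, f (t + 1) = f t) -> f (t + n%:R) = f t.
Proof. by move=> pf; elim: n => [|n IH]; rewrite ?addr0// -natr1 addrA pf. Qed.

Lemma periodic_int (T : Type) (f : R -> T) (n : int) t :
  (forall t, f (t + 1) = f t) -> f (t + n%:~R) = f t.
Proof.
move=> pf; case: n => n; first exact: periodic_nat.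
by rewrite NegzE mulrNz -(periodic_nat n.+1 (t - _)) // subrK.
Qed.

Lemma ge0_integral_periodic (a : R) (f : R -> \bar R) :
  measurable_fun [set: R] f -> (forall r, 0 <= f r)%E -> (forall t, f (t + 1) = f t) ->
  (\int[mu]_(x in `[0%R, 1%R]) f (x + a)%R = \int[mu]_(x in `[0%R, 1%R]) f x)%E.
Proof.
move=> mf f0 pf.
(* By periodicity only the fractional part of [a] matters. *)
pose b := a - (Num.floor a)%:~R.
have /andP[b0 b1] : 0 <= b < 1.
  by have := floor_itv a; rewrite /b intrD => /andP[? ?]; apply/andP; split; lra.
have mfa (c : R) : measurable_fun [set: R] (fun x => f (x + c)).
  by apply: (measurableT_comp mf); exact: measurable_shift.
rewrite -!integral_itv_bndo_bndc; last 2 first.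
- exact: measurable_funS mf.
- exact: measurable_funS (mfa a).
have -> : (fun x => f (x + a)) = (fun x => f (x + b)).
  by apply/funext => x; rewrite -(periodic_int (Num.floor a) (x + b))// -addrA subrK.
rewrite ge0_integral_shift// add0r.
have split_at (c d e : R) : c <= d -> d <= e ->
   (\int[mu]_(x in `[c, e[) f x = \int[mu]_(x in `[c, d[) f x + \int[mu]_(x in `[d, e[) f x)%E.
  move=> cd de.
  have -> : `[c, e[%classic = `[c, d[%classic `|` `[d, e[%classic.
    by rewrite -itv_bndbnd_setU.
  rewrite ge0_integral_setU//=; first exact: measurable_funS mf.
  apply/disj_setPS => x [] /=; rewrite !in_itv/=; lra.
(* The shifted period [b, 1 + b) is cut at 1; its part [1, 1 + b) is then moved back onto [0, b),
   which completes [b, 1). *)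
rewrite (split_at b 1 (1 + b)) ?(ltW b1) ?lerDl// (split_at 0 b 1) ?(ltW b1)// addeC.
congr (_ + _)%E.
rewrite -[X in `[X, _[](add0r 1) [X in `[_, X[]addrC -ge0_integral_shift//.
by apply: eq_integral => x _; rewrite pf.
Qed.

End PeriodicIntegral.

(** * Means over one period and relations that hold almost everywhere *)

Section Mean.
Variable R : realType.
Implicit Types (f g : R -> R) (c d r : R).
Notation mu := (@lebesgue_measure R).
Notation I01 := (`[0%R, 1%R]%classic : set (measurableTypeR R)).

Definition ae01 (P : R -> Prop) := {ae mu, forall t, I01 t -> P t}.

#[local] Instance ae_lebesgue_filter : Filter (almost_everywhere mu).
Proof. exact: (@ae_filter_ringOfSetsType _ _ _ mu). Qed.

Lemma ae01S (P Q : R -> Prop) : (forall t, 0 <= t <= 1 -> P t -> Q t) -> ae01 P -> ae01 Q.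
Proof.
move=> PQ h; apply: (@filterS _ _ ae_lebesgue_filter _ _ _ h) => t Pt It.
by apply: PQ (Pt It); move: It; rewrite /= in_itv.
Qed.

Lemma ae01I (P Q : R -> Prop) : ae01 P -> ae01 Q -> ae01 (fun t => P t /\ Q t).
Proof. move=> hP hQ; apply: (@filterS2 _ _ ae_lebesgue_filter _ _ _ _ hP hQ) => t Pt Qt It.
by split; [exact: Pt|exact: Qt]. Qed.

Lemma ae01W (P : R -> Prop) : (forall t, P t) -> ae01 P.
Proof. move=> h; apply: (@filterS _ _ ae_lebesgue_filter setT); last exact: filterT.
by move=> t _ _; exact: h. Qed.

(** The interval has length 1, so the integral is an average. Integrability is bundled with the
    value, so that means can be added, negated and compared without further side conditions. *)
Definition has_mean f c := mu.-integrable I01 (EFin \o f) /\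
  (\int[mu]_(t in I01) (f t)%:E = c%:E)%E.

Lemma measure_I01 : mu I01 = 1%E.
Proof. by rewrite lebesgue_measure_itv/= lte_fin ltr01 -EFinB subr0. Qed.

Lemma integrable_has_mean f : mu.-integrable I01 (EFin \o f) -> exists c, has_mean f c.
Proof.
move=> fi; exists (fine (\int[mu]_(t in I01) (f t)%:E)); split => //.
by rewrite fineK//; exact: integrable_fin_num.
Qed.

Lemma has_mean_uniq f c d : has_mean f c -> has_mean f d -> c = d.
Proof. by move=> [_ fc] [_]; rewrite fc => -[]. Qed.

Lemma has_mean_cst c : has_mean (cst c) c.
Proof.
split; last by rewrite [LHS](@integral_cst _ _ _ mu _ _ c%:E)//= measure_I01 mule1.
apply: measurable_bounded_integrable => //; first by rewrite /= measure_I01 ltry.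
by exists `|c|; split; [exact: num_real|move=> M cM x _; exact: ltW].
Qed.

Lemma has_meanD f g c d : has_mean f c -> has_mean g d -> has_mean (f \+ g) (c + d).
Proof.
move=> [fi fc] [gi gd]; split; first by rewrite (_ : EFin \o _ = ((EFin \o f) \+ (EFin \o g))%E)//; exact: integrableD.
under eq_integral do rewrite EFinD.
by rewrite integralD// fc gd EFinD.
Qed.

Lemma has_meanN f c : has_mean f c -> has_mean (\- f) (- c).
Proof.
move=> [fi fc]; split; first by rewrite (_ : EFin \o _ = -%E \o (EFin \o f))//; exact: integrableN.
under eq_integral do rewrite /= EFinN -mulN1e.
by rewrite integralZl// fc mulN1e EFinN.
Qed.

Lemma has_mean_ext f g c : f =1 g -> has_mean f c -> has_mean g c.
Proof. by move=> /funext ->. Qed.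

Lemma has_mean_le f g c d : has_mean f c -> has_mean g d ->
  (forall t, 0 <= t <= 1 -> f t <= g t) -> c <= d.
Proof.
move=> [fi fc] [gi gd] fg; rewrite -lee_fin -fc -gd; apply: le_integral => //.
by move=> t; rewrite inE/= in_itv/= lee_fin; exact: fg.
Qed.

(** Transfers a mean across identities such as ln (x y) = ln x + ln y, which may fail at zeros,
    where [ln 0 = 0] by convention, but only on a null set. *)
Lemma has_mean_ae f g c : has_mean f c -> measurable_fun [set: R] g ->
  ae01 (fun t => g t = f t) -> has_mean g c.
Proof.
move=> [fi fc] mg gf.
have mgE : measurable_fun I01 (EFin \o g).
  by apply/measurable_EFinP; exact: measurable_funS mg.
have gfE : ae_eq mu I01 (EFin \o f) (EFin \o g).
  suff: ae01 (fun t => (EFin \o f) t = (EFin \o g) t) by [].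
  by apply: ae01S gf => t _ /= ->.
have mf := measurable_int _ fi.
split; last by rewrite -fc; apply/esym/ae_eq_integral.
apply/integrableP; split => //.
case/integrableP : fi => _; apply: le_lt_trans.
rewrite le_eqVlt; apply/orP; left; apply/eqP/ae_eq_integral => //.
- exact: measurableT_comp.
- exact: measurableT_comp.
- suff: ae01 (fun t => `|(EFin \o g) t|%E = `|(EFin \o f) t|%E) by [].
  by apply: ae01S gf => t _ /= ->.
Qed.

Lemma bounded_has_mean f M : measurable_fun [set: R] f -> (forall t, `|f t| <= M) ->
  exists2 c, has_mean f c & `|c| <= M.
Proof.
move=> mf fM; have [|c fc] := @integrable_has_mean f.
  apply: measurable_bounded_integrable => //; first by rewrite /= measure_I01 ltry.
    exact: measurable_funS mf.
  by exists M; split; [exact: num_real|move=> N MN x _; exact: le_trans (fM x) (ltW MN)].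
exists c => //; rewrite ler_norml.
rewrite (has_mean_le fc (has_mean_cst M)); last first.
  by move=> t _; rewrite (le_trans (ler_norm _) (fM t)).
rewrite (has_mean_le (has_mean_cst (- M)) fc)// => t _ /=.
by have := fM t; rewrite ler_norml => /andP[].
Qed.

Lemma ge0_has_mean_shift f c (a : R) :
  measurable_fun [set: R] f -> (forall t, 0 <= f t) -> (forall t, f (t + 1) = f t) ->
  has_mean f c -> has_mean (fun t => f (t + a)) c.
Proof.
move=> mf f0 fp [fi fc].
have If : (\int[mu]_(t in I01) (f (t + a))%:E = c%:E)%E.
  rewrite -fc; apply: (@ge0_integral_periodic _ a (EFin \o f)) => [|t|t].
  - exact/measurable_EFinP.
  - by rewrite lee_fin.
  - by rewrite /= fp.
split => //; apply/integrableP; split.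
  apply/measurable_EFinP; apply: measurable_funS (measurableT) _ _ => //.
  by apply: (measurableT_comp mf); exact: measurable_shift.
by under eq_integral do rewrite /= ger0_norm//; rewrite If ltry.
Qed.

(** Adding the constant [M] reduces to the nonnegative case. *)
Lemma bounded_has_mean_shift f M c (a : R) :
  measurable_fun [set: R] f -> (forall t, `|f t| <= M) -> (forall t, f (t + 1) = f t) ->
  has_mean f c -> has_mean (fun t => f (t + a)) c.
Proof.
move=> mf fM fp fc.
have := has_meanD (ge0_has_mean_shift a _ _ _ (has_meanD fc (has_mean_cst M)))
  (has_mean_cst (- M)).
rewrite addrK => h; apply: has_mean_ext (h _ _ _) => [t|||t].
- by rewrite /= addrK.
- exact: measurable_funD.
- by move=> t; rewrite /= -lerBlDr sub0r; have := fM t; rewrite ler_norml => /andP[].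
- by rewrite /= fp.
Qed.

(** Almost everywhere g - f equals its absolute value, whose mean is nonnegative. *)
Lemma has_mean_ae_le f g c d : has_mean f c -> has_mean g d ->
  measurable_fun [set: R] f -> measurable_fun [set: R] g ->
  ae01 (fun t => f t <= g t) -> c <= d.
Proof.
move=> fc gd mf mg fg; rewrite -subr_ge0.
have h := has_meanD gd (has_meanN fc).
have habs : has_mean (fun t => `|g t - f t|) (d - c).
  apply: (has_mean_ae h).
    by apply: measurableT_comp => //; exact: measurable_funB.
  by apply: ae01S fg => t _ fg; rewrite ger0_norm// subr_ge0.
by apply: (has_mean_le (has_mean_cst 0) habs) => t _ /=.
Qed.

(** The truncation min(f, |g|) is dominated by |g| at every point, hence integrable, and it agrees
    with [f] almost everywhere. *)
Lemma ge0_has_mean_dom f g d : has_mean g d ->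
  measurable_fun [set: R] f -> measurable_fun [set: R] g -> (forall t, 0 <= f t) ->
  ae01 (fun t => f t <= g t) -> exists c, has_mean f c.
Proof.
move=> [gi _] mf mg f0 fg.
pose h t := Num.min (f t) `|g t|.
have mh : measurable_fun [set: R] h.
  by apply: measurable_minr => //; exact: measurableT_comp.
have [|c hc] := @integrable_has_mean h.
  apply: (le_integrable _ _ _ gi) => //.
    by apply/measurable_EFinP; exact: measurable_funS mh.
  move=> t _; rewrite /= lee_fin /h ger0_norm ?ge_min ?lexx ?orbT//.
  by rewrite le_min f0 normr_ge0.
exists c; apply: (has_mean_ae hc) => //.
apply: ae01S fg => t _ fg; rewrite /h min_l//.
by rewrite (le_trans fg)// ler_norm.
Qed.

End Mean.

(** * The parametrized unit circle and its null fibers *)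

Section Circle.
Variable R : realType.
Implicit Types (s t : R) (a w z : R[i]).
Notation mu := (@lebesgue_measure R).

Definition circ t : R[i] := Complex (cth t) (sth t).

Lemma circD s t : circ (s + t) = circ s * circ t.
Proof.
rewrite /circ /cth /sth mulrDr sinD cosD; apply/eqP; rewrite eq_complex/=.
by rewrite eqxx/= addrC.
Qed.

Lemma circ0 : circ 0 = 1.
Proof. by rewrite /circ /cth /sth mulr0 cos0 sin0. Qed.

Lemma circ_half : circ (1 / 2) = -1.
Proof.
rewrite /circ /cth /sth (_ : 2 * pi * (1 / 2) = pi); last by field.
by rewrite cospi sinpi; apply/eqP; rewrite eq_complex/= oppr0 !eqxx.
Qed.

Lemma circ1 : circ 1 = 1.
Proof. by rewrite -[in circ 1](_ : 1 / 2 + 1 / 2 = 1) ?circD ?circ_half ?mulrNN ?mulr1//; field. Qed.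

Lemma circ_periodic t : circ (t + 1) = circ t.
Proof. by rewrite circD circ1 mulr1. Qed.

Lemma circX t n : circ t ^+ n = circ (n%:R * t).
Proof.
elim: n => [|n IH]; first by rewrite mul0r circ0.
by rewrite exprSr IH -circD -natr1 mulrDl mul1r.
Qed.

Lemma cmod_circ t : cmod (circ t) = 1.
Proof. by rewrite /cmod/= /cth /sth cos2Dsin2 sqrtr1. Qed.

Definition ccont (F : R -> R[i]) :=
  continuous (fun t => complex.Re (F t)) /\ continuous (fun t => complex.Im (F t)).

Lemma ccont_cst z : ccont (fun=> z).
Proof. by split => t; exact: cvg_cst. Qed.

Lemma ReD z w : complex.Re (z + w) = complex.Re z + complex.Re w.
Proof. by case: z w => ? ? []. Qed.

Lemma ImD z w : complex.Im (z + w) = complex.Im z + complex.Im w.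
Proof. by case: z w => ? ? []. Qed.

Lemma ccontD F G : ccont F -> ccont G -> ccont (fun t => F t + G t).
Proof.
move=> [rF iF] [rG iG]; split => t.
  under eq_fun do rewrite ReD.
  by apply: cvgD; [exact: rF|exact: rG].
under eq_fun do rewrite ImD.
by apply: cvgD; [exact: iF|exact: iG].
Qed.

Lemma ReM z w : complex.Re (z * w) =
  complex.Re z * complex.Re w - complex.Im z * complex.Im w.
Proof. by case: z w => ? ? []. Qed.

Lemma ImM z w : complex.Im (z * w) =
  complex.Re z * complex.Im w + complex.Im z * complex.Re w.
Proof. by case: z w => ? ? []. Qed.

Lemma ccontM F G : ccont F -> ccont G -> ccont (fun t => F t * G t).
Proof.
move=> [rF iF] [rG iG]; split => t.
  under eq_fun do rewrite ReM.
  by apply: cvgB; apply: cvgM; [exact: rF|exact: rG|exact: iF|exact: iG].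
under eq_fun do rewrite ImM.
by apply: cvgD; apply: cvgM; [exact: rF|exact: iG|exact: iF|exact: rG].
Qed.

Lemma ccont_circ : ccont circ.
Proof.
have h : continuous (fun t : R => 2 * pi * t) by move=> t; apply: cvgM; [exact: cvg_cst|exact: cvg_id].
split => t /=; rewrite /cth /sth.
  by apply: continuous_comp; [exact: h|exact: continuous_cos].
by apply: continuous_comp; [exact: h|exact: continuous_sin].
Qed.

Lemma ccontX F n : ccont F -> ccont (fun t => F t ^+ n).
Proof.
move=> cF; elim: n => [|n IH]; first exact: ccont_cst.
by under [X in ccont X]eq_fun do rewrite exprS; exact: ccontM.
Qed.

Lemma ccont_cmod F : ccont F -> continuous (fun t => cmod (F t)).
Proof.
move=> [rF iF] t; rewrite /cmod.
apply: (@continuous_comp _ _ _ (fun t => complex.Re (F t) ^+ 2 + complex.Im (F t) ^+ 2)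
  (@Num.sqrt R)); last exact: sqrt_continuous.
by apply: cvgD; apply: cvgM; [exact: rF|exact: rF|exact: iF|exact: iF].
Qed.

Lemma measurable_ln_cmod F : ccont F -> measurable_fun [set: R] (fun t => ln (cmod (F t))).
Proof.
move=> cF; apply: (measurableT_comp (@measurable_ln R)).
by apply: continuous_measurable_fun; exact: ccont_cmod.
Qed.

(** The cosine determines t in [0, 1] up to the reflection t -> 1 - t, so the fiber has at most two
    points there. *)
Lemma circ_fiber_null w : ae01 (fun t => circ t != w).
Proof.
(* Folding at 1/2 brings 2 pi t into [0, pi], where the cosine is injective. *)
pose fold t : R := if t <= 1 / 2 then t else 1 - t.
have fold_itv t : 0 <= t <= 1 -> 0 <= fold t <= 1 / 2.
  by rewrite /fold => /andP[? ?]; case: ifPn; rewrite -?ltNge => ?; apply/andP; split; lra.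
have cth_fold t : cth (fold t) = cth t.
  rewrite /fold; case: ifP => // _; rewrite -[RHS](congr1 (@complex.Re R) (circ_periodic t)).
  rewrite -[RHS](congr1 (@complex.Re R) (circ_periodic _))/=.
  have p1 s : cth (s + 1) = cth s by have [] := congr1 (fun z => (complex.Re z, complex.Im z)) (circ_periodic s).
  rewrite !p1 addrC p1 /cth mulrN cosN //.
pose S := [set t | 0 <= t <= 1 /\ circ t = w].
have finS : finite_set S.
  have [->|/set0P[s [s01 sw]]] := eqVneq S set0; first exact: finite_set0.
  apply: (@sub_finite_set _ _ [set fold s; 1 - fold s]); last exact: finite_set2.
  move=> t [t01 tw]; have : fold t = fold s.
    have hp (x : R) : 0 <= x <= 1 / 2 -> 2 * pi * x \in `[0, pi].
      by rewrite in_itv/= => /andP[x0 x1]; have := pi_gt0 R => p0; apply/andP; split; nra.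
    have := @cos_inj R _ _ (hp _ (fold_itv _ t01)) (hp _ (fold_itv _ s01)).
    rewrite -!/(cth _) !cth_fold => h.
    have : 2 * pi * fold t = 2 * pi * fold s by apply: h; move: sw; rewrite -tw => -[].
    by apply: mulfI; rewrite mulf_neq0// gt_eqF// pi_gt0.
  by rewrite {1}/fold; case: ifP => _ <-; [left|right; rewrite /= opprB addrC subrK].
exists S; split.
- exact/countable_measurable/finite_set_countable.
- exact/countable_lebesgue_measure0/finite_set_countable.
- move=> t /= /not_implyP[]; rewrite in_itv/= => t01 /negP.
  by rewrite negbK => /eqP.
Qed.

End Circle.

(** * Vanishing of the mean of log |1 - a w| for |a| <= 1 *)

Section Jensen.
Variable R : realType.
Implicit Types (s t r : R) (a w z : R[i]).
Notation mu := (@lebesgue_measure R).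
Notation I01 := (`[0%R, 1%R]%classic : set (measurableTypeR R)).

(** The exponent [n] is carried along because averaging over the half-period shift leads from (a, n)
    to (a^2, 2n). *)
Definition logfac a n t : R := ln (cmod (1 - a * circ t ^+ n)).

Lemma ccont_fac a n : ccont (fun t => 1 - a * circ t ^+ n).
Proof.
under [X in ccont X]eq_fun do rewrite -mulNr.
apply: ccontD; first exact: ccont_cst.
apply: ccontM; first exact: ccont_cst.
exact/ccontX/ccont_circ.
Qed.

Lemma measurable_logfac a n : measurable_fun [set: R] (logfac a n).
Proof. exact: (measurable_ln_cmod (ccont_fac a n)). Qed.

Lemma cmod_fac_le a n t : cmod a <= 1 -> cmod (1 - a * circ t ^+ n) <= 2.
Proof.
move=> a1; apply: (le_trans (ler_cmodB _ _)).
by rewrite cmod1 cmodM cmodX cmod_circ expr1n mulr1; lra.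
Qed.

Lemma cmod_fac_ge a n t : 1 - cmod a <= cmod (1 - a * circ t ^+ n).
Proof.
have := ler_cmod_dist 1 (a * circ t ^+ n).
by rewrite cmod1 cmodM cmodX cmod_circ expr1n mulr1.
Qed.

(** The bound depends on [r] alone, so it survives the passage from (a, n) to (a^2, 2n). *)
Lemma logfac_bound r a n t : r < 1 -> cmod a <= r ->
  `|logfac a n t| <= ln 2 - ln (1 - r).
Proof.
move=> r1 ar.
have r0 : 0 <= r := le_trans (cmod_ge0 a) ar.
have a1 : cmod a <= 1 by rewrite (le_trans ar)// ltW.
have lo : 1 - r <= cmod (1 - a * circ t ^+ n).
  by rewrite (le_trans _ (cmod_fac_ge a n t))// lerD2l lerN2.
have p0 : 0 < 1 - r by rewrite subr_gt0.
have q0 := lt_le_trans p0 lo.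
have h1 : logfac a n t <= ln 2 by rewrite ler_ln ?posrE// cmod_fac_le.
have h2 : ln (1 - r) <= logfac a n t by rewrite ler_ln ?posrE.
have h3 : ln (1 - r) <= 0 by rewrite ln_le0// lerBlDr lerDl.
have h4 : 0 <= ln 2 :> R by rewrite ln_ge0// ler1n.
by rewrite ler_norml; apply/andP; split; lra.
Qed.

(* (1 - x)(1 + x) = 1 - x^2 and a half-period shift double the exponent *)
Lemma logfac_double a n t : (0 < n)%N -> cmod a < 1 ->
  logfac a n t + logfac a n (t + (2 * n%:R)^-1) = logfac (a ^+ 2) (2 * n) t.
Proof.
move=> n0 a1.
have pos s : cmod (1 - a * circ s ^+ n) \is Num.pos.
  by rewrite posrE (lt_le_trans _ (cmod_fac_ge a n s))// subr_gt0.
rewrite /logfac -lnM// -cmodM; congr (ln (cmod _)).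
have -> : circ (t + (2 * n%:R)^-1) ^+ n = - circ t ^+ n.
  rewrite circD exprMn [X in _ * X](_ : _ = -1) ?mulrN1//.
  rewrite circX -(circ_half R); congr circ; field.
  by rewrite pnatr_eq0 -lt0n.
by rewrite mulnC exprM; ring.
Qed.

Lemma logfac_periodic a n t : logfac a n (t + 1) = logfac a n t.
Proof. by rewrite /logfac circ_periodic. Qed.

(** Adding the equal means of the function and of its shift gives 2c as the mean for (a^2, 2n).
    Since |a^2| <= r, the induction hypothesis applies to it, and each round halves the bound. *)
Lemma logfac_mean_bound r k n a c : r < 1 -> (0 < n)%N -> cmod a <= r ->
  has_mean (logfac a n) c -> `|c| <= (ln 2 - ln (1 - r)) / 2 ^+ k.
Proof.
move=> r1; elim: k n a c => [|k IH] n a c n0 ar ac.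
  have [d ad dM] := bounded_has_mean (measurable_logfac a n) (fun t => logfac_bound n t r1 ar).
  by rewrite expr0 divr1 (has_mean_uniq ac ad).
have ac' := bounded_has_mean_shift (2 * n%:R)^-1 (measurable_logfac a n)
  (fun t => logfac_bound n t r1 ar) (logfac_periodic a n) ac.
have a1 : cmod a < 1 := le_lt_trans ar r1.
have := has_meanD ac ac'.
move=> /(has_mean_ext (fun t => logfac_double t n0 a1)) /IH.
rewrite muln_gt0 n0 cmodX => /(_ isT) h.
have {}h : `|c + c| <= (ln 2 - ln (1 - r)) / 2 ^+ k.
  apply: h; rewrite (le_trans _ ar)// expr2 ler_piMl ?cmod_ge0// ltW//.
rewrite exprS invfM mulrCA -ler_pdivrMl ?invr_gt0// invrK.
by rewrite -[X in X * _](ger0_norm (ler0n R 2)) -normrM mulr_natl mulr2n.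
Qed.

Lemma logfac_mean_lt1 a : cmod a < 1 -> has_mean (logfac a 1) 0.
Proof.
move=> a1.
have [c ac _] := bounded_has_mean (measurable_logfac a 1)
  (fun t => logfac_bound 1 t a1 (lexx _)).
suff <- : c = 0 by [].
apply/eqP; rewrite -normr_le0.
have h : (fun k => geometric (ln 2 - ln (1 - cmod a)) (2^-1 : R) k) @ \oo --> (0 : R).
  by apply: cvg_geometric; rewrite ger0_norm ?invr_ge0// invf_lt1// ltr1n.
rewrite -(cvg_lim _ h)//; apply: limr_ge; first by apply/cvg_ex; exists 0.
apply: nearW => k; rewrite /geometric/= exprVn.
by apply: logfac_mean_bound ac; rewrite ?a1.
Qed.

(** A zero forces [circ t] to be the single point [a^-1]. *)
Lemma logfac_null a : ae01 (fun t => 1 - a * circ t ^+ 1 != 0).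
Proof.
apply: ae01S (circ_fiber_null a^-1) => t _; rewrite expr1.
apply: contraNneq => /eqP; rewrite subr_eq0 => /eqP at1.
have a0 : a != 0 by apply: contra_eq_neq at1 => ->; rewrite mul0r oner_neq0.
by apply/eqP; apply: (mulfI a0); rewrite -at1 divff.
Qed.

(** Radii below 1 that tend to 1; scaling by them moves a parameter of the closed disk into the open
    disk. *)
Let shrink n : R := 1 - n.+1%:R^-1.

Let shrink_cvg a t : cmod a <= 1 -> 1 - a * circ t ^+ 1 != 0 ->
  (fun n => logfac (RC (shrink n) * a) 1 t) @ \oo --> logfac a 1 t.
Proof.
move=> a1 h.
(* Parametrized by the distance s from the radius to 1, so that the limit is continuity at s = 0
   along the harmonic sequence. *)
pose g (s : R) := cmod (1 - (RC (1 - s) * a) * circ t ^+ 1).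
have cg : continuous g.
  apply: ccont_cmod => /=; under [X in ccont X]eq_fun do rewrite -mulNr -mulNr.
  apply: ccontD; first exact: ccont_cst.
  apply: ccontM; last exact: ccont_cst.
  apply: ccontM; last exact: ccont_cst.
  split => s /=; rewrite ?oppr0; last exact: cvg_cst.
  by apply: cvgN; apply: cvgB; [exact: cvg_cst|exact: cvg_id].
have g0 : g 0 = cmod (1 - a * circ t ^+ 1).
  by rewrite /g subr0 (_ : RC 1 = 1)// mul1r.
suff: (@ln R \o g) (harmonic n) @[n --> \oo] --> (@ln R \o g) 0 by rewrite /= g0.
have lg : {for 0, continuous (@ln R \o g)}.
  apply: continuous_comp; first exact: cg.
  by apply: continuous_ln; rewrite g0 cmod_gt0.
by have := cvg_comp _ _ (@cvg_harmonic R) lg.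
Qed.

Let shrink_itv n : 0 <= shrink n < 1.
Proof.
rewrite /shrink subr_ge0 invf_le1 ?ltr0n// ler1n/=.
by rewrite ltrBlDr ltrDl invr_gt0 ltr0n.
Qed.

Let cmod_shrink a n : cmod a <= 1 -> cmod (RC (shrink n) * a) < 1.
Proof.
move=> a1; have /andP[s0 s1] := shrink_itv n.
rewrite cmodM cmod_RC ger0_norm// (le_lt_trans _ s1)//.
by rewrite ler_piMr.
Qed.

(* |1 - w| <= |1 - s w| + (1 - s) <= 2 |1 - s w| *)
Let shrink_dom a n t : cmod a <= 1 -> 1 - a * circ t ^+ 1 != 0 ->
  `|logfac (RC (shrink n) * a) 1 t| <= ln 2 + ln 2 - logfac a 1 t.
Proof.
move=> a1 h; have /andP[s0 s1] := shrink_itv n.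
set s := shrink n in s0 s1 *.
pose w := a * circ t ^+ 1.
have w1 : cmod w <= 1 by rewrite /w cmodM cmodX cmod_circ expr1n mulr1.
have sw : 1 - s <= cmod (1 - RC s * w).
  have := ler_cmod_dist 1 (RC s * w).
  rewrite cmod1 cmodM cmod_RC ger0_norm//; apply: le_trans.
  by rewrite lerD2l lerN2 ler_piMr.
have d2 : cmod (1 - w) <= 2 * cmod (1 - RC s * w).
  rewrite (_ : 1 - w = (1 - RC s * w) - RC (1 - s) * w); last first.
    rewrite (_ : RC (1 - s) = 1 - RC s); first ring.
    by apply/eqP; rewrite eq_complex/= subr0 !eqxx.
  rewrite (le_trans (ler_cmodB _ _))// mulr_natl mulr2n lerD2l (le_trans _ sw)//.
  rewrite cmodM cmod_RC ger0_norm ?ler_piMr// subr_ge0 ltW//.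
have pos0 : 0 < cmod (1 - w) by rewrite cmod_gt0.
have pos1 : 0 < cmod (1 - RC s * w).
  by rewrite (lt_le_trans _ sw)// subr_gt0.
have l1 : logfac a 1 t <= ln 2 + logfac (RC s * a) 1 t.
  rewrite /logfac -mulrA -lnM ?posrE// ler_ln ?posrE// mulr_gt0//.
have l2 : logfac (RC s * a) 1 t <= ln 2.
  rewrite /logfac -mulrA ler_ln ?posrE// mulrA cmod_fac_le// ltW//.
  exact: cmod_shrink.
have l3 : logfac a 1 t <= ln 2 by rewrite /logfac ler_ln ?posrE// cmod_fac_le.
have l4 : 0 <= ln 2 :> R by rewrite ln_ge0// ler1n.
by rewrite ler_norml; apply/andP; split; lra.
Qed.

(* Fatou along s a with s -> 1^- *)
Lemma logfac_integrable a : cmod a <= 1 -> mu.-integrable I01 (EFin \o logfac a 1).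
Proof.
move=> a1.
pose f n t : \bar R := (ln 2 - logfac (RC (shrink n) * a) 1 t)%:E.
have mf n : measurable_fun I01 (f n).
  apply/measurable_EFinP; apply: measurable_funS (measurableT) _ _ => //.
  by apply: measurable_funB => //; exact: measurable_logfac.
have f0 n t : I01 t -> (0 <= f n t)%E.
  move=> _; rewrite lee_fin subr_ge0 /logfac.
  have c2 := cmod_fac_le 1 t (ltW (cmod_shrink n a1)).
  rewrite ler_ln ?posrE// (lt_le_trans _ (cmod_fac_ge _ _ _))// subr_gt0.
  exact: cmod_shrink.
(* The parameter lies in the open disk, so every approximant has integral ln 2, and Fatou's lemma
   bounds the integral of the limit by ln 2. *)
have If n : (\int[mu]_(t in I01) f n t = (ln 2)%:E)%E.
  have [_] := has_meanD (has_mean_cst (ln 2))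
    (has_meanN (logfac_mean_lt1 (cmod_shrink n a1))).
  by rewrite oppr0 addr0.
have mI : measurable I01 by [].
have := fatou mu mI mf f0.
under [X in limn_einf X]eq_fun do rewrite If.
rewrite (is_cvg_limn_einfE (is_cvg_cst _)) lim_cst// => fat.
have l4 : 0 <= ln 2 :> R by rewrite ln_ge0// ler1n.
(* This also holds at a zero of the factor, where [ln 0 = 0] lies below ln 2. *)
have g0 t : 0 <= ln 2 - logfac a 1 t.
  rewrite subr_ge0 /logfac.
  have [->|h] := eqVneq (1 - a * circ t ^+ 1) 0; first by rewrite cmod0 ln0.
  by rewrite ler_ln ?posrE ?cmod_gt0// cmod_fac_le.
have mg : measurable_fun I01 (EFin \o (fun t => ln 2 - logfac a 1 t)).
  apply/measurable_EFinP; apply: measurable_funS (measurableT) _ _ => //.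
  by apply: measurable_funB => //; exact: measurable_logfac.
have gi : mu.-integrable I01 (EFin \o (fun t => ln 2 - logfac a 1 t)).
  apply/integrableP; split => //.
  under eq_integral do rewrite /= ger0_norm//.
  apply: le_lt_trans (ltry (ln 2)); apply: le_trans fat.
  apply: ae_ge0_le_integral => //.
  - by move=> t _; rewrite lee_fin.
  - move=> t It; rewrite limn_einf_lim; apply: lime_ge; first exact: is_cvg_einfs.
    by apply: nearW => n; apply: le_ereal_inf_tmp => _ [m _ <-]; exact: f0.
  - rewrite (_ : (fun _ => _) = (fun t => - limn_esup (-%E \o f ^~ t))%E); last first.
      by apply/funext => t; rewrite limn_esupN oppeK.
    apply: measurableT_comp => //; apply: measurable_fun_limn_esup => n.
    exact: measurableT_comp.
  - apply: ae01S (logfac_null a) => t _ h.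
    have fc : f ^~ t @ \oo --> (ln 2 - logfac a 1 t)%:E.
      apply: cvg_EFin; first exact: nearW.
      by apply: cvgB; [exact: cvg_cst|exact: shrink_cvg h].
    rewrite is_cvg_limn_einfE; last by apply/cvg_ex; eexists; exact: fc.
    by rewrite (cvg_lim _ fc).
have := integrableB mI
  (has_mean_cst (ln 2)).1 gi.
apply: eq_integrable => // t _ /=.
by rewrite -EFinB opprB addrCA subrr addr0.
Qed.

(** Dominated convergence along the shrinking radii; the majorant 2 ln 2 - log |1 - a w| is
    integrable by the preceding lemma. *)
Lemma logfac_mean a : cmod a <= 1 -> has_mean (logfac a 1) 0.
Proof.
move=> a1; have ai := logfac_integrable a1; split => //.
have mI : measurable I01 by [].
have gi : mu.-integrable I01 (fun t => (ln 2 + ln 2 - logfac a 1 t)%:E).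
  have := integrableB mI
    (has_mean_cst (ln 2 + ln 2)).1 ai.
  by apply: eq_integrable.
have mE b : measurable_fun I01 (EFin \o logfac b 1).
  apply/measurable_EFinP; apply: measurable_funS (measurableT) _ _ => //.
  exact: measurable_logfac.
have cf : {ae mu, forall t, I01 t ->
    (fun n => (logfac (RC (shrink n) * a) 1 t)%:E) @ \oo --> (logfac a 1 t)%:E}.
  suff : ae01 (fun t => (fun n => (logfac (RC (shrink n) * a) 1 t)%:E) @ \oo -->
    (logfac a 1 t)%:E) by [].
  apply: ae01S (logfac_null a) => t _ k.
  by apply: cvg_EFin; [exact: nearW|exact: shrink_cvg k].
have df : {ae mu, forall t n, I01 t ->
    (`|(logfac (RC (shrink n) * a) 1 t)%:E| <= (ln 2 + ln 2 - logfac a 1 t)%:E)%E}.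
  have h : ae01 (fun t => forall n,
      (`|(logfac (RC (shrink n) * a) 1 t)%:E| <= (ln 2 + ln 2 - logfac a 1 t)%:E)%E).
    by apply: ae01S (logfac_null a) => t _ k n; rewrite lee_fin; exact: shrink_dom k.
  by apply: (@filterS _ _ (ae_lebesgue_filter R) _ _ _ h) => t k n /k.
have [_ _ h] := @dominated_convergence _ _ R mu I01 mI
  (fun n t => (logfac (RC (shrink n) * a) 1 t)%:E) (fun t => (logfac a 1 t)%:E)
  _ (fun n => mE _) (mE a) cf gi df.
apply/esym; apply: (cvg_unique _ _ h) => //.
apply: cvg_near_cst; apply: nearW => n.
by have [_] := logfac_mean_lt1 (cmod_shrink n a1).
Qed.

End Jensen.

(** * Jensen's inequality for polynomials on the circle *)

Section JensenPolynomial.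
Variable R : realType.
Implicit Types (s : seq R[i]) (t : R) (p : {poly R[i]}) (a z : R[i]).

(** A common normal form: polynomials with nonzero constant term and products of denominators both
    have modulus a constant times such a product on the circle. *)
Definition facprod s t : R := \prod_(a <- s) cmod (1 - a * circ t ^+ 1).

Definition disk_seq s := all (fun a => cmod a <= 1) s.

Lemma facprod_ge0 s t : 0 <= facprod s t.
Proof. by apply: prodr_ge0 => a _; exact: cmod_ge0. Qed.

Lemma measurable_facprod s : measurable_fun [set: R] (facprod s).
Proof.
apply: continuous_measurable_fun; rewrite /facprod; elim: s => [|a s IH] t.
  by under eq_fun do rewrite big_nil; exact: cvg_cst.
under eq_fun do rewrite big_cons.
by apply: cvgM; [exact: (ccont_cmod (ccont_fac a 1))|exact: IH].
Qed.

Lemma facprod_neq0 s : ae01 (fun t => facprod s t != 0).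
Proof.
elim: s => [|a s IH].
  by apply: ae01W => t; rewrite /facprod big_nil oner_neq0.
apply: ae01S (ae01I (logfac_null a) IH) => t _ [at0 st0].
by rewrite /facprod big_cons mulf_neq0// cmod_eq0.
Qed.

Lemma measurable_ln_facprod s : measurable_fun [set: R] (fun t => ln (facprod s t)).
Proof. exact: (measurableT_comp (@measurable_ln R) (measurable_facprod s)). Qed.

Lemma facprod_mean s : disk_seq s -> has_mean (fun t => ln (facprod s t)) 0.
Proof.
elim: s => [_|a s IH sa].
  apply: has_mean_ext (has_mean_cst 0) => t.
  by rewrite /facprod big_nil ln1.
have /andP[a1 s1] := sa; have := has_meanD (logfac_mean a1) (IH s1).
rewrite addr0 => /has_mean_ae; apply; first exact: measurable_ln_facprod.
apply: ae01S (ae01I (logfac_null a) (facprod_neq0 s)) => t _ [at0 st0].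
by rewrite {1}/facprod big_cons lnM ?posrE ?cmod_gt0// lt0r st0 facprod_ge0.
Qed.

(* A root z of modulus < 1 is reflected to the outside: |w - z| = |1 - conj(z) w| on the circle *)
Lemma cmod_circ_sub z : z != 0 -> exists a C, [/\ cmod a <= 1, cmod z <= C &
  forall t, cmod (circ t - z) = C * cmod (1 - a * circ t ^+ 1)].
Proof.
move=> z0; have [z1|z1] := leP 1 (cmod z).
  exists z^-1, (cmod z); split => //.
    by rewrite cmodV invf_le1// (lt_le_trans ltr01).
  move=> t; rewrite -cmodM mulrBr mulr1 mulrA divff// mul1r expr1.
  by rewrite -cmodN opprB.
exists (conjc z), 1; split; [by rewrite cmodJ ltW|exact: ltW|move=> t].
rewrite mul1r expr1 -[RHS]cmodJ.
have -> : circ t - z = circ t * conjc (1 - conjc z * circ t).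
  rewrite rmorphB rmorphM rmorph1/= conjcK mulrBr mulr1 mulrCA.
  suff -> : circ t * conjc (circ t) = 1 by rewrite mulr1.
  have := cmod_sqr (circ t); rewrite cmod_circ expr1n => /= h.
  by apply/eqP; rewrite eq_complex/= mulrN opprK -!expr2 -h eqxx/= mulrN mulrC addNr.
by rewrite cmodM cmod_circ mul1r.
Qed.

(** Splitting into linear factors, [C] collects the modulus of the leading coefficient and max(1,
    |z|) for each root z. It is the Mahler measure, and it dominates |p(0)|. *)
Lemma cmod_horner_circ p : p.[0] != 0 -> exists s C, [/\ disk_seq s, cmod p.[0] <= C &
  forall t, cmod p.[circ t] = C * facprod s t].
Proof.
have [r ->] := closed_field_poly_normal p.
rewrite hornerZ mulf_eq0 negb_or => /andP[lc0].
elim: r => [_|z r IH].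
  exists [::], (cmod (lead_coef p)); split => // [|t].
    by rewrite big_nil hornerE mulr1.
  by rewrite big_nil /facprod big_nil hornerZ hornerE !mulr1.
rewrite big_cons hornerM hornerXsubC mulf_eq0 negb_or sub0r oppr_eq0.
move=> /andP[z0 /IH [s [C [ds pC hC]]]].
have [a [D [a1 zD hD]]] := cmod_circ_sub z0.
exists (a :: s), (D * C); split => [||t]; first by rewrite /disk_seq/= a1.
  rewrite mulrCA cmodM cmodN ler_pM ?cmod_ge0//.
rewrite scalerAr hornerM hornerXsubC cmodM hC hD /facprod big_cons.
by rewrite mulrACA.
Qed.

Lemma ccont_horner p : ccont (fun t => p.[circ t]).
Proof.
elim/poly_ind: p => [|p c IH].
  by under [X in ccont X]eq_fun do rewrite horner0; exact: ccont_cst.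
under [X in ccont X]eq_fun do rewrite hornerMXaddC.
by apply: ccontD; [apply: ccontM => //; exact: ccont_circ|exact: ccont_cst].
Qed.

Lemma horner_circ_neq0 p : p.[0] != 0 -> ae01 (fun t => p.[circ t] != 0).
Proof.
move=> p0; have [s [C [ds pC hC]]] := cmod_horner_circ p0.
apply: ae01S (facprod_neq0 s) => t _ st0.
rewrite -cmod_eq0 hC mulf_neq0// gt_eqF// (lt_le_trans _ pC)//.
by rewrite cmod_gt0.
Qed.

(** The mean equals ln [C], because the factors |1 - a w| contribute 0. *)
Lemma jensen_horner_circ p : p.[0] != 0 -> exists2 c,
  has_mean (fun t => ln (cmod p.[circ t])) c & ln (cmod p.[0]) <= c.
Proof.
move=> p0; have [s [C [ds pC hC]]] := cmod_horner_circ p0.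
have pp : 0 < cmod p.[0] by rewrite cmod_gt0.
have C0 : 0 < C := lt_le_trans pp pC.
exists (ln C); last by rewrite ler_ln.
have := has_meanD (has_mean_cst (ln C)) (facprod_mean ds).
rewrite addr0 => /has_mean_ae; apply; first exact: (measurable_ln_cmod (ccont_horner p)).
apply: ae01S (facprod_neq0 s) => t _ st0.
by rewrite hC lnM// posrE lt0r st0 facprod_ge0.
Qed.

End JensenPolynomial.

(** * The scalar denominator and its factorization on the circle *)

Section Denominator.
Variable R : realType.
Implicit Types (s t : R).
Variable l2 : R.
Hypothesis l2_itv : 0 <= l2 <= 1.

Definition den t : R[i] := Complex (l2 * cth t) (- lamp l2).

Lemma lamp_itv (l : R) : 0 <= l <= 1 -> 0 <= lamp l <= 1.
Proof.
move=> /andP[l0 l1]; rewrite sqrtr_ge0/= -[leRHS]sqrtr1 ler_sqrt//.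
by rewrite lerBlDr lerDl sqr_ge0.
Qed.

Lemma lamp_sqr (l : R) : 0 <= l <= 1 -> lamp l ^+ 2 = 1 - l ^+ 2.
Proof. by move=> /andP[l0 l1]; rewrite sqr_sqrtr// subr_ge0 expr_le1. Qed.

Let rho := l2 / (1 + lamp l2).

(** Expressed through the sine to match the determinant of the numerator matrix. *)
Lemma cmod_den_sqr t : cmod (den t) ^+ 2 = 1 - l2 ^+ 2 * sth t ^+ 2.
Proof.
rewrite cmod_sqr/= sqrrN lamp_sqr// exprMn.
have := cos2Dsin2 (2 * pi * t); rewrite -/(cth t) -/(sth t) => h.
by rewrite -[in RHS](addrK (cth t ^+ 2) (sth t ^+ 2)) [sth t ^+ 2 + _]addrC h; ring.
Qed.

(** Both sides are squared. With s = [sth t] the two factors have squared moduli 1 + rho^2 + 2 rho s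
    and 1 + rho^2 - 2 rho s, and (1 + rho^2)(1 + l2') = 2. *)
Lemma cmod_den t : cmod (den t) = (1 + lamp l2) / 2 *
  (cmod (1 - Complex 0 rho * circ t) * cmod (1 - Complex 0 (- rho) * circ t)).
Proof.
have /andP[d0 d1] := lamp_itv l2_itv.
have p0 : 0 < 1 + lamp l2 by rewrite ltr_pwDl.
apply/eqP; rewrite -(@eqrXn2 _ 2)//; last 2 first.
- exact: cmod_ge0.
- by rewrite !mulr_ge0 ?cmod_ge0// ltW.
rewrite cmod_den_sqr !exprMn !cmod_sqr/= /rho.
have := cos2Dsin2 (2 * pi * t); rewrite -/(cth t) -/(sth t) => h.
have hc : cth t ^+ 2 = 1 - sth t ^+ 2 by rewrite -h addrK.
have hl := lamp_sqr l2_itv.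
set q := l2 / _.
have qE : q * (1 + lamp l2) = l2 by rewrite mulfVK// gt_eqF.
have q2 : (1 + q ^+ 2) * (1 + lamp l2) = 2.
  apply: (mulIf (lt0r_neq0 p0)).
  rewrite -mulrA -expr2 mulrDl -exprMn qE.
  move: hl; set d := lamp l2; move=> hl; lra.
have -> : (1 - (0 * cth t - q * sth t)) ^+ 2 + (0 - (0 * sth t + q * cth t)) ^+ 2 =
  1 + q ^+ 2 + 2 * q * sth t by ring: hc.
have -> : (1 - (0 * cth t - - q * sth t)) ^+ 2 + (0 - (0 * sth t + - q * cth t)) ^+ 2 =
  1 + q ^+ 2 - 2 * q * sth t by ring: hc.
move: qE q2; move: q (lamp l2) => q d qE q2; rewrite -qE; apply/eqP.
transitivity (((1 + q ^+ 2) * (1 + d)) ^+ 2 / 4 - q ^+ 2 * (1 + d) ^+ 2 * sth t ^+ 2).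
  by rewrite q2; field.
by field.
Qed.

Let rho_le1 (e : R) : `|e| = 1 -> cmod (Complex 0 (e * rho)) <= 1.
Proof.
move=> e1; have /andP[d0 d1] := lamp_itv l2_itv; have /andP[l0 l1] := l2_itv.
have p0 : 0 < 1 + lamp l2 by rewrite ltr_pwDl.
rewrite /cmod/= expr0n add0r sqrtr_sqr normrM e1 mul1r ger0_norm.
  by rewrite ler_pdivrMr// mul1r (le_trans l1)// lerDl.
by rewrite divr_ge0// ltW.
Qed.

(** A shift multiplies the parameters by [circ s], which keeps them in the disk. *)
Lemma cmod_den_shift s : exists2 r, disk_seq r & forall t,
  cmod (den (t + s)) = (1 + lamp l2) / 2 * facprod r t.
Proof.
exists [:: Complex 0 rho * circ s; Complex 0 (- rho) * circ s] => [|t].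
  rewrite /disk_seq/= !cmodM !cmod_circ !mulr1 andbT -[X in Complex 0 X]mul1r.
  by rewrite -mulN1r !rho_le1// ?normrN normr1.
have e z : z * circ (t + s) = z * circ s * circ t by rewrite circD mulrA mulrAC.
by rewrite cmod_den /facprod big_cons big_seq1 !expr1 !e.
Qed.

Lemma cmod_prod_den (Phi : R) n : exists2 r, disk_seq r & forall t,
  cmod (\prod_(k < n) den (t + k%:R * Phi)) = ((1 + lamp l2) / 2) ^+ n * facprod r t.
Proof.
elim: n => [|n [r dr rE]].
  by exists [::] => // t; rewrite big_ord0 cmod1 /facprod big_nil mul1r.
have [q dq qE] := cmod_den_shift (n%:R * Phi).
exists (r ++ q) => [|t]; first by rewrite /disk_seq all_cat; apply/andP.
rewrite big_ord_recr cmodM rE/= qE exprSr /facprod big_cat/=.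
by rewrite mulrACA.
Qed.

End Denominator.

(** * Fekete's lemma for nonnegative subadditive sequences *)

Section Fekete.
Variable R : realType.

Lemma subadditive_mul_add (a : nat -> R) (m q r : nat) :
  (forall m n, a (m + n)%N <= a m + a n) -> a (q * m + r)%N <= q%:R * a m + a r.
Proof.
move=> sub; elim: q => [|q IH]; first by rewrite mul0r add0r.
rewrite mulSn -addnA (le_trans (sub _ _))// -natr1 mulrDl mul1r.
by move: IH; lra.
Qed.

(** The limit is the infimum of a(n) / n over n >= 1: dividing n by a nearly optimal block length
    bounds a(n) / n by the block average plus a vanishing remainder. *)
Lemma fekete (a : nat -> R) : (forall n, 0 <= a n) ->
  (forall m n, a (m + n)%N <= a m + a n) ->
  cvgn (fun n => n%:R^-1 * a n).
Proof.
move=> a0 sub.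
(* Indices start at 1, since at 0 the convention [0^-1 = 0] would put 0 into the set. *)
pose S := [set n.+1%:R^-1 * a n.+1 | n in [set: nat]].
have S0 : S !=set0 by exists (1^-1 * a 1%N); exists 0%N.
have lS : has_lbound S by exists 0 => _ [n _ <-]; rewrite mulr_ge0.
have iS : has_inf S by split.
apply/cvg_ex; exists (inf S); apply/cvgrPdist_le => /= e e0.
have [_ [m _ <-] me] := inf_adherent (divr_gt0 e0 (ltr0n R 2)) iS.
(* The summands are nonnegative, so [B] bounds the term of every possible remainder modulo the block
   length [m.+1]. *)
pose B := \sum_(r < m.+1) a r.
have B0 : 0 <= B by rewrite sumr_ge0.
near=> n.
have n0 : (0 < n)%N by near: n; exact: nbhs_infty_gt.
have nr0 : 0 < n%:R :> R by rewrite ltr0n.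
have Bn : n%:R^-1 * B <= e / 2.
  rewrite mulrC ler_pdivrMr// mulrC -ler_pdivrMr ?divr_gt0//.
  by near: n; exact: nbhs_infty_ger.
have lo : inf S <= n%:R^-1 * a n.
  by apply: inf_lbound => //; exists n.-1 => //; rewrite prednK.
rewrite distrC ger0_norm ?subr_ge0// lerBlDl.
have hi : n%:R^-1 * a n <= m.+1%:R^-1 * a m.+1 + n%:R^-1 * B.
  rewrite {2}(divn_eq n m.+1).
  rewrite (le_trans (ler_wpM2l _ (subadditive_mul_add _ _ _ sub)))// mulrDr lerD//.
    rewrite mulrA ler_wpM2r// mulrC ler_pdivrMr// ler_pdivlMl ?ltr0n//.
    by rewrite -natrM ler_nat mulnC leq_divM.
  rewrite ler_wpM2l ?invr_ge0//.
  rewrite /B (bigD1 (Ordinal (ltn_pmod n (ltn0Sn m))))//= lerDl.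
  by rewrite sumr_ge0.
by rewrite (le_trans hi)// [e in leRHS]splitr addrA lerD// ltW.
Unshelve. all: by end_near. Qed.

End Fekete.

(** * The cocycle as numerator over denominator, and its measurability *)

Section Cocycle.
Variables (R : realType) (l1 l2 : R) (z : R[i]) (Phi : R).
Implicit Types (s t : R) (n : nat).

(** The part of [Amat] that stays bounded and continuous where the denominator may vanish. *)
Definition num_mx t : 'M[R[i]]_2 :=
  let a11 : R[i] := z^-1 / RC l1 + RC (2 * lamp l1 * l2 * sth t / l1)
                    + z * RC (lamp l1 ^+ 2 / l1) in
  let a12 : R[i] := - RC (l2 * sth t) - RC (lamp l1) * z in
  let a22 : R[i] := RC l1 * z in
  \matrix_(i < 2, j < 2)
     (if (i == 0 :> nat) then (if (j == 0 :> nat) then a11 else a12)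
      else (if (j == 0 :> nat) then a12 else a22)).

Lemma AmatE t : Amat l1 l2 z t = (den l2 t)^-1 *: num_mx t.
Proof. by []. Qed.

Fixpoint num_iter n t : 'M[R[i]]_2 :=
  if n is n'.+1 then num_mx (t + n'%:R * Phi) *m num_iter n' t else 1%:M.

Definition den_prod n t : R[i] := \prod_(k < n) den l2 (t + k%:R * Phi).

Lemma AiterE n t : Aiter l1 l2 z Phi n t = (den_prod n t)^-1 *: num_iter n t.
Proof.
elim: n => [|n IH]; first by rewrite /den_prod big_ord0 invr1 scale1r.
rewrite /= AmatE IH -scalemxAl -scalemxAr scalerA /den_prod big_ord_recr/=.
by rewrite invfM mulrC.
Qed.

Lemma opnorm_Aiter n t : opnorm (Aiter l1 l2 z Phi n t) =
  (cmod (den_prod n t))^-1 * opnorm (num_iter n t).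
Proof. by rewrite AiterE opnormZ cmodV. Qed.

Lemma Aiter_add m n t : Aiter l1 l2 z Phi (m + n) t =
  Aiter l1 l2 z Phi m (t + n%:R * Phi) *m Aiter l1 l2 z Phi n t.
Proof.
elim: m => [|m IH]; first by rewrite mul1mx.
have e : t + (m + n)%:R * Phi = t + n%:R * Phi + m%:R * Phi by rewrite natrD; ring.
by rewrite addSn [LHS]/= IH mulmxA e.
Qed.

Lemma cth_periodic t : cth (t + 1) = cth t.
Proof. by have [] := circ_periodic t. Qed.

Lemma sth_periodic t : sth (t + 1) = sth t.
Proof. by have [] := circ_periodic t. Qed.

Lemma Aiter_periodic n t : Aiter l1 l2 z Phi n (t + 1) = Aiter l1 l2 z Phi n t.
Proof.
have e s : Amat l1 l2 z (s + 1) = Amat l1 l2 z s.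
  by rewrite /Amat cth_periodic sth_periodic.
by elim: n => [//|n IH]; rewrite [LHS]/= IH addrAC e.
Qed.

Definition log_opnorm n t : R := ln (opnorm (Aiter l1 l2 z Phi n t)).

Lemma log_opnorm_periodic n t : log_opnorm n (t + 1) = log_opnorm n t.
Proof. by rewrite /log_opnorm Aiter_periodic. Qed.

Definition mx_ccont (F : R -> 'M[R[i]]_2) := forall i j, ccont (fun t => F t i j).

(** The Lipschitz bound [opnorm_dist] reduces this to continuity of the moduli of the entries of
    F(s) - F(t). *)
Lemma continuous_opnorm F : mx_ccont F -> continuous (fun t => opnorm (F t)).
Proof.
move=> cF t.
pose G s := entrysum (F s - F t).
have cG : continuous G.
  have h i j : continuous (fun s => cmod ((F s - F t) i j)).
    apply: ccont_cmod; under [X in ccont X]eq_fun do rewrite !mxE.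
    by apply: ccontD; [exact: cF|exact: ccont_cst].
  by move=> s; apply: cvgD; apply: cvgD; exact: h.
have G0 : G t = 0 by rewrite /G subrr /entrysum !mxE cmod0 !addr0.
apply/cvgrPdist_le => e e0.
have /cvgrPdist_le /(_ e e0) := cG t.
apply: filterS => s; rewrite G0 sub0r normrN => Ge.
rewrite distrC (le_trans (opnorm_dist _ _))// (le_trans _ Ge)//.
exact: ler_norm.
Qed.

Lemma ccont_RC (f : R -> R) : continuous f -> ccont (fun t => RC (f t)).
Proof. by move=> cf; split => // t; exact: cvg_cst. Qed.

Lemma continuous_sth_shift s : continuous (fun t => sth (t + s)).
Proof.
move=> t; rewrite /sth; apply: (@continuous_comp _ _ _ (fun t => 2 * pi * (t + s)) sin).
  by apply: cvgM; [exact: cvg_cst|apply: cvgD; [exact: cvg_id|exact: cvg_cst]].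
exact: continuous_sin.
Qed.

Lemma ccont_num_mx s : mx_ccont (fun t => num_mx (t + s)).
Proof.
have cs : continuous (fun t => sth (t + s)) by exact: continuous_sth_shift.
have c11 : ccont (fun t => z^-1 / RC l1 + RC (2 * lamp l1 * l2 * sth (t + s) / l1)
                    + z * RC (lamp l1 ^+ 2 / l1)).
  apply: ccontD; last exact: ccont_cst.
  apply: ccontD; first exact: ccont_cst.
  apply: ccont_RC => t; apply: cvgM; last exact: cvg_cst.
  by apply: cvgM; [exact: cvg_cst|exact: cs].
have c12 : ccont (fun t => - RC (l2 * sth (t + s)) - RC (lamp l1) * z).
  apply: ccontD; last exact: ccont_cst.
  under [X in ccont X]eq_fun do rewrite -mulN1r.
  apply: ccontM; first exact: ccont_cst.
  by apply: ccont_RC => t; apply: cvgM; [exact: cvg_cst|exact: cs].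
case=> [[|[|//]]] i [[|[|//]]] j; under [X in ccont X]eq_fun do rewrite mxE.
- exact: c11.
- exact: c12.
- exact: c12.
- exact: ccont_cst.
Qed.

Lemma ccont_num_iter n : mx_ccont (num_iter n).
Proof.
elim: n => [|n IH] i j; first exact: ccont_cst.
rewrite /=; under [X in ccont X]eq_fun do rewrite mxE big_ord_recl big_ord1.
by apply: ccontD; apply: ccontM; [exact: ccont_num_mx|exact: IH|exact: ccont_num_mx|exact: IH].
Qed.

Lemma ccont_den s : ccont (fun t => den l2 (t + s)).
Proof.
split => t /=; last exact: cvg_cst.
apply: cvgM; first exact: cvg_cst.
apply: (@continuous_comp _ _ _ (fun t => 2 * pi * (t + s)) cos).
  by apply: cvgM; [exact: cvg_cst|apply: cvgD; [exact: cvg_id|exact: cvg_cst]].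
exact: continuous_cos.
Qed.

Lemma ccont_den_prod n : ccont (den_prod n).
Proof.
rewrite /den_prod; elim: n => [|n IH].
  by under [X in ccont X]eq_fun do rewrite big_ord0; exact: ccont_cst.
under [X in ccont X]eq_fun do rewrite big_ord_recr.
by apply: ccontM => //; exact: ccont_den.
Qed.

Lemma measurable_log_opnorm n : measurable_fun [set: R] (log_opnorm n).
Proof.
apply: (measurableT_comp (@measurable_ln R)).
under eq_fun do rewrite opnorm_Aiter.
apply: measurable_funM.
  (* The inverse need not be continuous at a zero of the denominator; as a real power it is still
     measurable. *)
  under eq_fun do rewrite -powR_inv1 ?cmod_ge0//.
  apply: (measurableT_comp (measurable_powR (-1))).
  exact: continuous_measurable_fun (ccont_cmod (ccont_den_prod n)).
apply: continuous_measurable_fun.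
exact: (continuous_opnorm (ccont_num_iter n)).
Qed.

(** * Unimodular determinant, nonnegativity and subadditivity *)

Hypothesis l1_itv : 0 < l1 <= 1.
Hypothesis l2_itv : 0 < l2 <= 1.
Hypothesis z_neq0 : z != 0.

Let l2_itv0 : 0 <= l2 <= 1.
Proof. by have /andP[/ltW -> ->] := l2_itv. Qed.

Lemma RC_M (x y : R) : RC (x * y) = RC x * RC y.
Proof. exact: (rmorphM (real_complex R)). Qed.

Lemma RC_D (x y : R) : RC (x + y) = RC x + RC y.
Proof. exact: (rmorphD (real_complex R)). Qed.

Lemma RC_N (x : R) : RC (- x) = - RC x.
Proof. exact: (rmorphN (real_complex R)). Qed.

Lemma RC_1 : RC 1 = 1 :> R[i].
Proof. by []. Qed.

Lemma RC_V (x : R) : RC x^-1 = (RC x)^-1.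
Proof.
have [->|x0] := eqVneq x 0; first by rewrite invr0 (_ : RC 0 = 0)// invr0.
have r0 : RC x != 0 by rewrite -cmod_eq0 cmod_RC normr_eq0.
by apply: (mulfI r0); rewrite -RC_M !divff.
Qed.

(** All terms in z cancel, leaving the squared modulus of the denominator; this is why |det A| =
    1. *)
Lemma det_num_mx t : \det (num_mx t) = RC (1 - l2 ^+ 2 * sth t ^+ 2).
Proof.
have /andP[l10 _] := l1_itv.
have r0 : RC l1 != 0 by rewrite -cmod_eq0 cmod_RC normr_eq0 gt_eqF.
rewrite det_mx2 !mxE/=.
rewrite (_ : 2 = 1 + 1)// !expr2 !(RC_M, RC_V, RC_D, RC_N, RC_1).
by field; rewrite r0.
Qed.

Lemma cmod_det_Amat t : den l2 t != 0 -> cmod (\det (Amat l1 l2 z t)) = 1.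
Proof.
move=> d0; rewrite AmatE detZ cmodM cmodX cmodV det_num_mx -(cmod_den_sqr l2_itv0).
rewrite cmod_RC ger0_norm ?sqr_ge0// -exprMn mulVf ?expr1n//.
by rewrite cmod_eq0.
Qed.

(** The determinant of the iterate is unimodular, and |det| is at most the square of the operator
    norm. *)
Lemma opnorm_Aiter_ge1 n t : den_prod n t != 0 -> 1 <= opnorm (Aiter l1 l2 z Phi n t).
Proof.
move=> dn0.
have d1 : cmod (\det (Aiter l1 l2 z Phi n t)) = 1.
  elim: n dn0 => [|n IH]; first by rewrite det1 cmod1.
  rewrite /den_prod big_ord_recr/= mulf_eq0 negb_or => /andP[/IH h d0].
  by rewrite det_mulmx cmodM h cmod_det_Amat ?mulr1.
have := cmod_det2_le (Aiter l1 l2 z Phi n t); rewrite d1 => h.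
by rewrite leNgt; apply/negP => lt1; move: h; rewrite leNgt expr_lt1 ?opnorm_ge0// lt1.
Qed.

(* If [den_prod n t = 0] then [Aiter] is the zero matrix and [ln 0 = 0]. *)
Lemma log_opnorm_ge0 n t : 0 <= log_opnorm n t.
Proof.
have [dn0|dn0] := eqVneq (den_prod n t) 0; last exact/ln_ge0/opnorm_Aiter_ge1.
by rewrite /log_opnorm opnorm_Aiter dn0 cmod0 invr0 mul0r ln0.
Qed.

Lemma ln_le_addM (a b c : R) : 0 < c -> 0 <= a -> 0 <= b -> c <= a * b ->
  ln c <= ln a + ln b.
Proof.
move=> c0 a0 b0 cab; have ab0 := lt_le_trans c0 cab.
have aN0 : a != 0 by apply: contraTneq ab0 => ->; rewrite mul0r ltxx.
have bN0 : b != 0 by apply: contraTneq ab0 => ->; rewrite mulr0 ltxx.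
have ap : 0 < a by rewrite lt0r aN0.
have bp : 0 < b by rewrite lt0r bN0.
by rewrite -lnM ?ler_ln ?posrE.
Qed.

(** Submultiplicativity of the norm. If the product has norm 0, the left side is [ln 0 = 0] and the
    right side is nonnegative, so the inequality holds at every [t]. *)
Lemma log_opnorm_sub m n t :
  log_opnorm (m + n) t <= log_opnorm m (t + n%:R * Phi) + log_opnorm n t.
Proof.
have := log_opnorm_ge0 m (t + n%:R * Phi); have := log_opnorm_ge0 n t.
rewrite /log_opnorm Aiter_add.
move: (Aiter l1 l2 z Phi m _) (Aiter l1 l2 z Phi n t) => M N hN hM.
have [MN0|MN0] := eqVneq (opnorm (M *m N)) 0.
  by rewrite MN0 (ln0 (lexx 0)); exact: addr_ge0 hM hN.
apply: (ln_le_addM _ (opnorm_ge0 M) (opnorm_ge0 N) (opnormM M N)).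
by rewrite lt0r MN0 opnorm_ge0.
Qed.

Lemma opnorm_num_mx_bound : exists2 C, 0 < C & forall t, opnorm (num_mx t) <= C.
Proof.
have s1 t : `|sth t| <= 1 by rewrite ler_norml sin_le1 sin_geN1.
pose c11 := cmod (z^-1 / RC l1) + `|2 * lamp l1 * l2 / l1| + cmod (z * RC (lamp l1 ^+ 2 / l1)).
pose c12 := `|l2| + cmod (RC (lamp l1) * z).
have c11_ge0 : 0 <= c11 by rewrite !addr_ge0 ?cmod_ge0.
have c12_ge0 : 0 <= c12 by rewrite addr_ge0 ?cmod_ge0.
(* The summand 1 makes the constant positive. *)
exists (1 + (c11 + c12 + (c12 + cmod (RC l1 * z)))) => [|t].
  by rewrite ltr_pwDl// !addr_ge0 ?cmod_ge0.
apply: (le_trans (opnorm_le_entrysum _)); rewrite /entrysum !mxE/=.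
have h11 : cmod (z^-1 / RC l1 + RC (2 * lamp l1 * l2 * sth t / l1)
    + z * RC (lamp l1 ^+ 2 / l1)) <= c11.
  rewrite (le_trans (ler_cmodD _ _))// lerD// (le_trans (ler_cmodD _ _))// lerD//.
  by rewrite cmod_RC [_ * sth t / _]mulrAC normrM ler_piMr.
have h12 : cmod (- RC (l2 * sth t) - RC (lamp l1) * z) <= c12.
  rewrite (le_trans (ler_cmodB _ _))// lerD// cmodN cmod_RC normrM ler_piMr//.
by rewrite ler_wpDl// !lerD.
Qed.

(** * Polynomial form of the numerator iterates and their constant terms *)

Definition sinpoly s : {poly R[i]} :=
  (Complex 0 (2^-1))%:P * ((circ (- s))%:P - (circ s)%:P * 'X^2).

(** Euler's formula; the factor w = [circ t] clears the negative frequency, whose coefficient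
    becomes the constant term. *)
Lemma horner_sinpoly s t : (sinpoly s).[circ t] = circ t * RC (sth (t + s)).
Proof.
rewrite /sinpoly !hornerE.
have -> : sth (t + s) = sth t * cth s + cth t * sth s by rewrite /sth /cth mulrDr sinD.
have -> : circ (- s) = Complex (cth s) (- sth s).
  by rewrite /circ /cth /sth mulrN cosN sinN.
have ht : cth t ^+ 2 + sth t ^+ 2 = 1 by rewrite /cth /sth cos2Dsin2.
apply/eqP; rewrite eq_complex; apply/andP; split; rewrite -subr_eq0; apply/eqP => /=.
  transitivity (- (sth s / 2) * (cth t ^+ 2 + sth t ^+ 2 - 1)); first by field.
  by rewrite ht subrr mulr0.
transitivity (- (cth s / 2) * (cth t ^+ 2 + sth t ^+ 2 - 1)); first by field.
by rewrite ht subrr mulr0.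
Qed.

Lemma horner0_sinpoly s : (sinpoly s).[0] = Complex 0 2^-1 * circ (- s).
Proof. by rewrite /sinpoly !hornerE /= mulr0 subr0. Qed.

(* (x, -1) is an eigenvector, for the eigenvalue x, of [[2 l1'/l1, -1], [-1, 0]], the
   coefficient of e^{-2 pi i t} in the numerator matrix up to a scalar of modulus l2 / 2 *)
Let x := (1 + lamp l1) / l1.

(** First row of the eigenvalue equation, a quadratic with roots (l1' + 1) / l1 and (l1' - 1) /
    l1. *)
Let x_eq : 2 * lamp l1 / l1 * x + 1 = x * x.
Proof.
have /andP[l10 l11] := l1_itv.
have h : lamp l1 ^+ 2 = 1 - l1 ^+ 2 by rewrite lamp_sqr// (ltW l10).
have h' : l1 ^+ 2 = 1 - lamp l1 ^+ 2 by rewrite h; ring.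
by rewrite /x; field: h'; rewrite gt_eqF.
Qed.

(** Multiplication by w^n turns N^n v, with v = (x, -1), into a vector of polynomials. At w = 0 each
    step acts as a scalar times a real matrix with eigenvector v, so the constant term remains a
    multiple [k] of v. *)
Lemma num_iter_poly n : exists p q k, [/\ cmod k = (l2 / 2 * x) ^+ n,
  p.[0] = k * RC x, q.[0] = - k &
  forall t, let v := num_iter n t *m \col_i (if i == 0 then RC x else -1) in
    circ t ^+ n * v 0 0 = p.[circ t] /\ circ t ^+ n * v 1 0 = q.[circ t]].
Proof.
have /andP[l10 l11] := l1_itv; have /andP[l20 l21] := l2_itv.
elim: n => [|n [p [q [k [kE p0 q0 pq]]]]].
  exists (RC x)%:P, (-1)%:P, 1; split => [||| t v].
  - by rewrite cmod1 expr0.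
  - by rewrite hornerC mul1r.
  - by rewrite hornerC.
  - by rewrite /v mul1mx !mxE !hornerC expr0 !mul1r.
set s := n%:R * Phi.
(* These are w times the entries of [num_mx (t + s)]; only the sine terms contribute to the constant
   terms. *)
pose e11 := (z^-1 / RC l1 + z * RC (lamp l1 ^+ 2 / l1))%:P * 'X +
  (RC (2 * lamp l1 * l2 / l1))%:P * sinpoly s.
pose e12 := - (RC l2)%:P * sinpoly s - (RC (lamp l1) * z)%:P * 'X.
pose e22 := (RC l1 * z)%:P * 'X : {poly R[i]}.
have z11 : e11.[0] = RC (2 * lamp l1 * l2 / l1) * (Complex 0 2^-1 * circ (- s)).
  by rewrite hornerD hornerM hornerX mulr0 add0r hornerM hornerC horner0_sinpoly.
have z12 : e12.[0] = - RC l2 * (Complex 0 2^-1 * circ (- s)).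
  rewrite /e12 hornerD hornerN [X in _ - X]hornerM hornerX mulr0 subr0.
  by rewrite hornerM hornerN hornerC horner0_sinpoly.
have z22 : e22.[0] = 0 by rewrite hornerM hornerX mulr0.
(* Each step multiplies [k] by (i/2) e^{-2 pi i s}, [l2] and the eigenvalue [x], hence its modulus
   by l2 x / 2. *)
exists (e11 * p + e12 * q), (e12 * p + e22 * q),
  (Complex 0 2^-1 * circ (- s) * RC l2 * RC x * k); split.
- rewrite !cmodM kE cmod_circ !cmod_RC mulr1 exprS.
  have -> : cmod (Complex 0 2^-1 : R[i]) = 2^-1.
    by rewrite /cmod/= expr0n add0r sqrtr_sqr ger0_norm// invr_ge0.
  rewrite !ger0_norm ?(ltW l20)//; last by rewrite divr_ge0 ?addr_ge0 ?sqrtr_ge0// ltW.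
  by rewrite [2^-1 * l2]mulrC !mulrA.
- rewrite hornerD (hornerM e11) (hornerM e12) z11 z12 p0 q0.
  have -> : RC (2 * lamp l1 * l2 / l1) = RC l2 * (RC (2 * lamp l1 / l1)).
    by rewrite -RC_M; congr RC; ring.
  have h : RC (2 * lamp l1 / l1) * RC x + 1 = RC x * RC x.
    by rewrite -!RC_M -x_eq RC_D.
  move: (Complex 0 2^-1 * circ (- s)) => c.
  transitivity (c * RC l2 * k * (RC (2 * lamp l1 / l1) * RC x + 1)); first ring.
  by rewrite h; ring.
- rewrite hornerD (hornerM e12) (hornerM e22) z12 z22 p0 q0.
  by ring.
move=> t v.
have [hp hq] := pq t.
have s11 : circ t * num_mx (t + s) 0 0 = e11.[circ t].
  rewrite /e11 hornerD hornerM hornerC hornerX hornerM hornerC horner_sinpoly !mxE/=.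
  have -> : RC (2 * lamp l1 * l2 * sth (t + s) / l1) = RC (2 * lamp l1 * l2 / l1) * RC (sth (t + s)).
    by rewrite -RC_M; congr RC; ring.
  ring.
have s12 : circ t * (- RC (l2 * sth (t + s)) - RC (lamp l1) * z) = e12.[circ t].
  rewrite /e12 hornerD hornerN [X in _ = _ - X]hornerM hornerC hornerX.
  by rewrite hornerM hornerN hornerC horner_sinpoly RC_M; ring.
have s22 : circ t * num_mx (t + s) 1 1 = e22.[circ t].
  by rewrite /e22 hornerM hornerC hornerX !mxE/=; ring.
have v0 : v = num_mx (t + s) *m (num_iter n t *m \col_i (if i == 0 then RC x else -1)).
  by rewrite /v/= mulmxA.
split.
  rewrite v0 mulmx2E hornerD (hornerM e11) (hornerM e12) -hp -hq -s11 -s12 exprS.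
  by rewrite [num_mx _ 0 1]mxE/=; ring.
rewrite v0 mulmx2E hornerD (hornerM e12) (hornerM e22) -hp -hq -s22 -s12 exprS.
by rewrite [num_mx _ 1 0]mxE/=; ring.
Qed.

(* Projecting onto the eigenvector gives a scalar polynomial to which Jensen applies *)
Lemma opnorm_num_iter_ge n : exists2 p : {poly R[i]}, cmod p.[0] = (l2 / 2 * x) ^+ n &
  forall t, cmod p.[circ t] <= opnorm (num_iter n t).
Proof.
have [p [q [k [kE p0 q0 pq]]]] := num_iter_poly n.
have N0 : 0 < x ^+ 2 + 1 by rewrite ltr_wpDl ?sqr_ge0.
(* This is the pairing of w^n N^n v with v = (x, -1), divided by |v|^2 = x^2 + 1, which makes the
   constant term exactly [k]. *)
exists ((RC (x ^+ 2 + 1)^-1)%:P * ((RC x)%:P * p - q)) => [|t].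
  rewrite hornerM hornerC hornerD hornerN hornerM hornerC p0 q0 -kE.
  suff -> : RC x * (k * RC x) - - k = RC (x ^+ 2 + 1) * k.
    by rewrite mulrA -RC_M mulVf ?gt_eqF// mul1r.
  by rewrite RC_D expr2 RC_M RC_1; ring.
have [] := pq t; set v := \col_i _ => hp hq.
rewrite hornerM hornerC hornerD hornerN hornerM hornerC -hp -hq mulrCA -mulrBr mulrCA cmodM cmodX cmod_circ expr1n mul1r cmodM cmod_RC.
rewrite ger0_norm ?invr_ge0 ?(ltW N0)// ler_pdivrMl//.
have vE : vnorm v = Num.sqrt (x ^+ 2 + 1).
  by rewrite /vnorm !mxE/= cmod_RC cmodN cmod1 expr1n real_normK// num_real.
have := cmod_dot (RC x) (-1) ((num_iter n t *m v) 0 0) ((num_iter n t *m v) 1 0).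
rewrite mulN1r => /le_trans; apply.
rewrite cmod_RC cmodN cmod1 expr1n real_normK ?num_real//.
rewrite -/(vnorm (num_iter n t *m v)).
apply: (le_trans (ler_wpM2l (sqrtr_ge0 _) (vnorm_mulmx _ _))).
by rewrite vE mulrCA -expr2 sqr_sqrtr ?(ltW N0)// mulrC.
Qed.

(** * Means of the logarithmic norms and the lower bound for the limit *)

Let den0 := (1 + lamp l2) / 2.

Let den0_gt0 : 0 < den0.
Proof. by rewrite divr_gt0// ltr_pwDl// sqrtr_ge0. Qed.

Lemma den_prod_neq0 n : ae01 (fun t => den_prod n t != 0).
Proof.
have [r dr rE] := cmod_prod_den l2_itv0 Phi n.
apply: ae01S (facprod_neq0 r) => t _ rt.
by rewrite -cmod_eq0 rE mulf_neq0// expf_neq0// gt_eqF.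
Qed.

Lemma ln_den_prod_mean n :
  has_mean (fun t => ln (cmod (den_prod n t))) (ln den0 *+ n).
Proof.
have [r dr rE] := cmod_prod_den l2_itv0 Phi n.
have := has_meanD (has_mean_cst (ln den0 *+ n)) (facprod_mean dr).
rewrite addr0 => /has_mean_ae; apply.
  exact: (measurable_ln_cmod (ccont_den_prod n)).
apply: ae01S (facprod_neq0 r) => t _ rt.
have rp : 0 < facprod r t by rewrite lt0r rt facprod_ge0.
by rewrite rE lnM ?posrE ?exprn_gt0// lnXn.
Qed.

(** The function lies between 0 and log C^n - log |d_n| almost everywhere, with d_n the product of
    the denominators; the upper function is integrable. *)
Lemma log_opnorm_mean n : exists c, has_mean (log_opnorm n) c.
Proof.
have [C C0 hC] := opnorm_num_mx_bound.
have hN t : opnorm (num_iter n t) <= C ^+ n.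
  elim: n => [|n IH].
    by rewrite expr0; apply: opnorm_le => v v1; rewrite mul1mx v1.
  rewrite exprS (le_trans (opnormM _ _))// ler_pM ?opnorm_ge0//.
have h := has_meanD (has_mean_cst (ln (C ^+ n))) (has_meanN (ln_den_prod_mean n)).
apply: (ge0_has_mean_dom h).
- exact: measurable_log_opnorm.
- apply: measurable_funB => //; exact: (measurable_ln_cmod (ccont_den_prod n)).
- exact: log_opnorm_ge0.
apply: ae01S (den_prod_neq0 n) => t _ dn0.
have dp : 0 < cmod (den_prod n t) by rewrite cmod_gt0.
have Cn : 0 < C ^+ n by rewrite exprn_gt0.
rewrite /= -ln_div ?posrE// ler_ln ?posrE ?divr_gt0//.
  by rewrite opnorm_Aiter mulrC ler_pM2r ?invr_gt0.
exact: lt_le_trans ltr01 (opnorm_Aiter_ge1 dn0).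
Qed.

(** Off a null set |p(w)| / |d_n| <= ||A^n||. Jensen's inequality bounds the mean of log |p| from
    below, and the mean of log |d_n| is known exactly. *)
Lemma log_opnorm_mean_ge n c : has_mean (log_opnorm n) c ->
  (ln (l2 / 2 * x) - ln den0) *+ n <= c.
Proof.
move=> hc; have [p p0 hp] := opnorm_num_iter_ge n.
have /andP[l10 l11] := l1_itv; have /andP[l20 l21] := l2_itv.
have xp : 0 < l2 / 2 * x by rewrite !(mulr_gt0, divr_gt0, invr_gt0)// ltr_pwDl// sqrtr_ge0.
have pn0 : p.[0] != 0 by rewrite -cmod_gt0 p0 exprn_gt0.
have [b hb] := jensen_horner_circ pn0.
rewrite p0 lnXn// => le_b.
have h := has_meanD hb (has_meanN (ln_den_prod_mean n)).
apply: (@le_trans _ _ (b - ln den0 *+ n)); first by rewrite mulrnBl lerD2r.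
apply: (has_mean_ae_le h hc).
- apply: measurable_funB; first exact: (measurable_ln_cmod (ccont_horner p)).
  exact: (measurable_ln_cmod (ccont_den_prod n)).
- exact: measurable_log_opnorm.
apply: ae01S (ae01I (den_prod_neq0 n) (horner_circ_neq0 pn0)) => t _ [dn0 pt0].
have dp : 0 < cmod (den_prod n t) by rewrite cmod_gt0.
have pp : 0 < cmod p.[circ t] by rewrite cmod_gt0.
rewrite /= -ln_div ?posrE// ler_ln ?posrE ?divr_gt0//.
  by rewrite opnorm_Aiter mulrC ler_pM2l ?invr_gt0.
exact: lt_le_trans ltr01 (opnorm_Aiter_ge1 dn0).
Qed.

Lemma ln_ratioE : ln ((l2 * (1 + lamp l1)) / (l1 * (1 + lamp l2))) =
  ln (l2 / 2 * x) - ln den0.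
Proof.
have /andP[l10 l11] := l1_itv; have /andP[l20 l21] := l2_itv.
have p1 : 0 < 1 + lamp l1 by rewrite ltr_pwDl// sqrtr_ge0.
have p2 : 0 < 1 + lamp l2 by rewrite ltr_pwDl// sqrtr_ge0.
have xp : 0 < l2 / 2 * x by rewrite mulr_gt0 ?divr_gt0.
rewrite -ln_div ?posrE//; congr ln.
by rewrite /x /den0; field; rewrite !gt_eqF.
Qed.

(** Translation along the orbit preserves means, so the means of the logarithmic norms form a
    subadditive sequence, each term of which satisfies the bound. *)
Lemma lyap_ge :
  ((ln ((l2 * (1 + lamp l1)) / (l1 * (1 + lamp l2))))%:E <= lyap l1 l2 Phi z)%E.
Proof.
have [a ha] := choice log_opnorm_mean.
have a0 n : 0 <= a n.
  by apply: (has_mean_le (has_mean_cst 0) (ha n)) => t _; exact: log_opnorm_ge0.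
have sub m n : a (m + n)%N <= a m + a n.
  have hm := ge0_has_mean_shift (n%:R * Phi) (measurable_log_opnorm m)
    (log_opnorm_ge0 m) (log_opnorm_periodic m) (ha m).
  apply: (has_mean_le (ha (m + n)%N) (has_meanD hm (ha n))) => t _.
  exact: log_opnorm_sub.
have lE : lyap_seq l1 l2 Phi z = (fun n => (n%:R^-1 * a n)%:E).
  by apply/funext => n; rewrite /lyap_seq (ha n).2.
(* A bound on the terms passes to [lim] once convergence is known. *)
have cv := fekete a0 sub.
rewrite /lyap lE; apply: lime_ge.
  by apply/cvg_ex; exists (limn (fun n => n%:R^-1 * a n))%:E; apply: cvg_EFin => //; exact: nearW.
near=> n.
have n0 : (0 < n)%N by near: n; exact: nbhs_infty_gt.
rewrite lee_fin ler_pdivlMl ?ltr0n// mulr_natl ln_ratioE.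
exact: log_opnorm_mean_ge.
Unshelve. all: by end_near. Qed.

End Cocycle.

Theorem theorem4p6 (R : realType) (Phi : R) :
  (forall q : rat, Phi != ratr q) ->
  (forall (l1 l2 : R) (z : R[i]),
      0 < l1 <= 1 -> 0 <= l2 <= 1 -> z != 0 ->
      ((if l2 == 0%R then -oo
        else (ln ((l2 * (1 + lamp l1)) / (l1 * (1 + lamp l2))))%:E)
       <= lyap l1 l2 Phi z)%E)
  /\
  (forall (l1 l2 : R) (z : R[i]),
      0 < l1 -> l1 < l2 -> l2 <= 1 -> cmod z = 1 ->
      (0 < lyap l1 l2 Phi z)%E)
  /\
  (forall (l2 : R) (z : R[i]),
      0 < l2 <= 1 -> cmod z = 1 ->
      lyap l1 l2 Phi z @[l1 --> 0^'+] --> +oo%E).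
Proof.
move=> _; split; last split.
- move=> l1 l2 z l1_itv /andP[l20 l21] z0; case: eqVneq => [_|l2n0]; first exact: leNye.
  by apply: lyap_ge => //; rewrite lt0r l2n0 l20.
- move=> l1 l2 z l10 l12 l21 z1.
  have l20 := lt_trans l10 l12; have l11 := le_trans (ltW l12) l21.
  have z0 : z != 0 by rewrite -cmod_gt0 z1.
  have l1_itv : 0 < l1 <= 1 by rewrite l10.
  have l2_itv : 0 < l2 <= 1 by rewrite l20.
  apply: lt_le_trans (lyap_ge Phi l1_itv l2_itv z0); rewrite lte_fin ln_gt0//.
  have p2 : 0 < 1 + lamp l2 by rewrite ltr_pwDl// sqrtr_ge0.
  rewrite ltr_pdivlMr ?mulr_gt0// mul1r.
  (* The chain l1 (1 + l2') < l2 (1 + l2') <= l2 (1 + l1'); the last step holds because [lamp] is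
     decreasing. *)
  apply: (@lt_le_trans _ _ (l2 * (1 + lamp l2))); first by rewrite ltr_pM2r.
  rewrite ler_pM2l// lerD2l /lamp ler_wsqrtr// lerD2l lerN2.
  by rewrite ler_sqr ?nnegrE ltW.
- move=> l2 z l2_itv z1; have /andP[l20 l21] := l2_itv.
  have z0 : z != 0 by rewrite -cmod_gt0 z1.
  apply/cvgeyPge => A; near=> l1.
  have l10 : 0 < l1 by near: l1; exact: nbhs_right_gt.
  have l11 : l1 <= 1 by near: l1; exact: nbhs_right_le.
  have l1_itv : 0 < l1 <= 1 by rewrite l10.
  apply: le_trans (lyap_ge Phi l1_itv l2_itv z0); rewrite lee_fin.
  have p1 : 1 <= 1 + lamp l1 by rewrite lerDl sqrtr_ge0.
  have p2 : 0 < 1 + lamp l2 by rewrite ltr_pwDl// sqrtr_ge0.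
  have p2' : 1 + lamp l2 <= 2.
    have /andP[_ l2'] : 0 <= lamp l2 <= 1 by apply: lamp_itv; rewrite l21 ltW.
    by rewrite -[2]/(1 + 1) lerD2l.
  (* Since 1 + l1' >= 1 and 1 + l2' <= 2, the ratio is at least l2 / (2 l1), which reaches e^A once
     l1 <= l2 / (2 e^A). *)
  have l1A : l1 * (2 * expR A) <= l2.
    rewrite -ler_pdivlMr ?mulr_gt0 ?expR_gt0//; near: l1; apply: nbhs_right_le.
    by rewrite divr_gt0// mulr_gt0// expR_gt0.
  rewrite -[A]expRK ler_ln ?posrE ?expR_gt0//; last first.
    by rewrite divr_gt0 ?mulr_gt0// (lt_le_trans ltr01).
  rewrite ler_pdivlMr ?mulr_gt0//.
  apply: (@le_trans _ _ l2); last by rewrite ler_peMr// ltW.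
  apply: le_trans l1A; rewrite mulrCA ler_pM2l// mulrC ler_pM2r ?expR_gt0//.
Unshelve. all: by end_near. Qed.
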